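(* Let $\alpha,\eta,\nu\in(0,1)$ be constants. Given a Label Cover instance $\mathcal{L}=(U_{\mathcal L},V_{\mathcal L},E_{\mathcal L},[k],[s],\{\pi_{v\to u}\}_{(u,v)\in E_{\mathcal L}})$, there exists an efficient procedure (depending on $\eta$) which outputs a $4$-Lin instance $H=(V_H,E_H)$ such that: (1) if $\mathcal{L}$ is $1$-satisfiable (i.e. $\mathsf{Val}(\mathcal L)=1$), then there exists an assignment $\sigma:V_H\to\{0,1\}$ which satisfies at least a $(1-2\eta)$-fraction of the constraints in $H$; (2) if there exists a subset $S\subseteq V_H$ of size at least $\alpha|V_H|$ and an assignment $\sigma:S\to\{0,1\}$ which satisfies at least a $(1/2+\nu)$-fraction of the constraints of $E_H$ all of whose variables lie in $S$, then $\mathsf{Val}(\mathcal L)\ge\Omega(\nu\alpha^{16}\eta^2)$.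
   Context: A (bipartite) Label Cover instance $\mathcal{L}(U_{\mathcal L},V_{\mathcal L},E_{\mathcal L},[k],[s],\{\pi_e\})$ consists of a bi-regular bipartite (multi)graph with sides $U_{\mathcal L},V_{\mathcal L}$ and edge multiset $E_{\mathcal L}$, where each edge $e=(u,v)$ carries a projection $\pi_{v\to u}:[k]\to[s]$; labels of $U_{\mathcal L}$ come from $[s]$ and of $V_{\mathcal L}$ from $[k]$, and a labeling satisfies $(u,v)$ if $\pi_{v\to u}(\text{label of }v)=\text{label of }u$. $\mathsf{Val}(\mathcal L)$ is the maximum fraction of constraints satisfiable by a labeling. A $4$-Lin instance $H=(V_H,E_H)$ has variable set $V_H$ taking values in $\mathbb{F}_2$ and a (multi)set $E_H$ of linear equations over $\mathbb{F}_2$, each on $4$ variables. *)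

(* Defs.v *)
From mathcomp Require Import all_boot all_order all_algebra.
From mathcomp Require Import reals.

Set Implicit Arguments.
Unset Strict Implicit.
Unset Printing Implicit Defensive.

Import Order.TTheory GRing.Theory Num.Theory.
Local Open Scope ring_scope.

(* An edge is (u, v, pi) with pi = pi_{v -> u}; the edge multiset is a list,
   so parallel edges may carry different projections. *)
Definition lc_edge (nU nV k s : nat) : Type :=
  ('I_nU * 'I_nV * {ffun 'I_k -> 'I_s})%type.

Record label_cover (k s : nat) := LabelCover {
  lcU : nat;
  lcV : nat;
  lcE : seq (lc_edge lcU lcV k s);
  lc_labels : (0 < k)%N;
  lc_nonempty : (0 < size lcE)%N;
  lc_regU : exists d, forall u, count (fun e => e.1.1 == u) lcE = d;
  lc_regV : exists d, forall v, count (fun e => e.1.2 == v) lcE = d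
}.

Definition labeling k s (L : label_cover k s) : Type :=
  ({ffun 'I_(lcU L) -> 'I_s} * {ffun 'I_(lcV L) -> 'I_k})%type.

Definition lc_sat k s (L : label_cover k s) (l : labeling L)
    (e : lc_edge (lcU L) (lcV L) k s) : bool :=
  e.2 (l.2 e.1.2) == l.1 e.1.1.

Definition Val (R : realType) k s (L : label_cover k s) : R :=
  (\max_(l : labeling L) count (lc_sat l) (lcE L))%:R / (size (lcE L))%:R.

(* (t, b) stands for the equation sum of the variables in t = b. *)
Definition lin_eqn (n : nat) : Type := (4.-tuple 'I_n * 'F_2)%type.

Record lin4 := Lin4 {
  lin_nvar : nat;
  lin_eqs : seq (lin_eqn lin_nvar);
  lin_distinct : all (fun e : lin_eqn lin_nvar => uniq e.1) lin_eqs
}.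

Definition lin_sat (H : lin4) (sigma : 'I_(lin_nvar H) -> 'F_2)
    (e : lin_eqn (lin_nvar H)) : bool :=
  \sum_(i <- e.1) sigma i == e.2.

Definition lin_induced (H : lin4) (S : {set 'I_(lin_nvar H)}) :
    seq (lin_eqn (lin_nvar H)) :=
  [seq e : lin_eqn (lin_nvar H) <- lin_eqs H | all (fun i => i \in S) e.1].

(* Model of computation: a first-order functional language over binary trees,
   with de Bruijn variables, whose only recursion is iteration over the right
   spine of a tree, read as a list.  Evaluating any expression is charged the
   full size of its value on top of the cost of evaluating its
   subexpressions, so that sharing cannot hide large intermediate values:
   a multitape Turing machine simulates a run in time polynomial in the input
   size plus the cost. *)
Inductive tree := Leaf | Node of tree & tree.

Fixpoint tsize (t : tree) : nat :=
  if t is Node l r then (tsize l + tsize r).+1 else 1%N.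

Inductive expr :=
  | EVar of nat
  | ELeaf
  | ENode of expr & expr
  | ELet of expr & expr           (* body sees: value, env *)
  | ECase of expr & expr & expr   (* Node branch sees: left, right, env *)
  | EFold of expr & expr & expr.  (* list, start; step sees: head, acc, env *)

Fixpoint tfoldl (A : Type) (f : tree -> A -> A) (l : tree) (a : A) : A :=
  if l is Node h t then tfoldl f t (f h a) else a.

Definition charge (vc : tree * nat) : tree * nat :=
  (vc.1, (tsize vc.1 + vc.2)%N).

(* exec env e = (value, cost) *)
Fixpoint exec (env : seq tree) (e : expr) : tree * nat :=
  charge match e with
  | EVar i => (nth Leaf env i, 0%N)
  | ELeaf => (Leaf, 0%N)
  | ENode a b =>
      let: (va, ca) := exec env a in
      let: (vb, cb) := exec env b in
      (Node va vb, (ca + cb)%N)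
  | ELet a b =>
      let: (va, ca) := exec env a in
      let: (vb, cb) := exec (va :: env) b in
      (vb, (ca + cb)%N)
  | ECase a b c =>
      let: (va, ca) := exec env a in
      let: (vr, cr) :=
        if va is Node h t then exec (h :: t :: env) c else exec env b in
      (vr, (ca + cr)%N)
  | EFold l a f =>
      let: (vl, cl) := exec env l in
      let: (va, ca) := exec env a in
      tfoldl (fun h acc =>
        let: (w, cw) := exec (h :: acc.1 :: env) f in (w, (acc.2 + cw)%N))
        vl (va, (cl + ca)%N)
  end.

Definition eval (P : expr) (x : tree) : tree := (exec [:: x] P).1.
Definition cost (P : expr) (x : tree) : nat := (exec [:: x] P).2.

(* Numbers are encoded in unary.  This changes the size of an instance only
   polynomially for fixed k and s: vertex indices and the vertex counts of a
   bi-regular nonempty instance are at most the number of edges. *)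
Definition enc_nat (n : nat) : tree := iter n (Node Leaf) Leaf.

Definition enc_seq (T : Type) (enc : T -> tree) (l : seq T) : tree :=
  foldr (fun x t => Node (enc x) t) Leaf l.

Definition enc_edge nU nV k s (e : lc_edge nU nV k s) : tree :=
  Node (enc_nat e.1.1)
    (Node (enc_nat e.1.2)
      (enc_seq (fun i => enc_nat (e.2 i)) (enum 'I_k))).

Definition enc_lc k s (L : label_cover k s) : tree :=
  Node (enc_nat (lcU L))
    (Node (enc_nat (lcV L))
      (Node (enc_nat k)
        (Node (enc_nat s) (enc_seq (@enc_edge _ _ k s) (lcE L))))).

Definition enc_eqn n (e : lin_eqn n) : tree :=
  Node (enc_seq (fun i : 'I_n => enc_nat i) e.1) (enc_nat (e.2 : nat)).

Definition enc_lin4 (H : lin4) : tree :=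
  Node (enc_nat (lin_nvar H)) (enc_seq (@enc_eqn _) (lin_eqs H)).

(* One program for all alphabets, running in polynomial time when the
   alphabet sizes k and s are constants. *)
Definition efficient (P : expr) : Prop :=
  forall k s : nat, exists C d : nat, forall L : label_cover k s,
    (cost P (enc_lc L) <= C * tsize (enc_lc L) ^ d)%N.

Definition outputs (P : expr) k s (L : label_cover k s) (H : lin4) : Prop :=
  eval P (enc_lc L) = enc_lin4 H.

(* Main.v *)
(* A variable is a triple (v, x, c) with v in V, x in {0,1}^k and c in [s] a copy
   index.  Writing f_v for (-1)^sigma on the cloud of v, an equation reads
     f_v(x, c1) f_v(x + z o p + mu + b, c2) f_v'(y, c3) f_v'(y + z o p' + mu', c4) = (-1)^b
   for edges (u, v), (u, v') with projections p, p', a uniform z in {0,1}^s, noises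
   mu, mu' flipping every bit with probability 1/q, where 1 <= eta q <= 2, and
   pairwise distinct copies, which make the four variables distinct.  The dictator
   assignment of a satisfying labeling only fails because of the noise.

   Conversely, let f be supported on S and averaged over the copies.  The mean of the
   signed test is a combination, with nonnegative coefficients, of the
   f^_v(a)^2 f^_v'(a')^2 (1 - 2/q)^(|a| + |a'|): the sign (-1)^b kills the even |a|, and
   z kills the pairs (a, a') that have different images under p and p'; in every other
   pair some p i with i in a equals some p' i' with i' in a'.  Giving v a uniform label
   of a with probability f^_v(a)^2 thus shows that Val is at least 4/q^2 times that
   mean.  Without the sign, the empty frequencies alone show that S spans an alpha^4
   fraction of the tests.  Tests with colliding copies are an O(1/s) fraction, which
   Val >= 1/s absorbs.

   As for the running time, whatever depends only on k, s, q and two projections takes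
   finitely many values and costs a constant; only the loops over pairs of edges and
   the unary arithmetic on vertices have to be estimated. *)
Require Import Defs.
From mathcomp Require Import all_boot all_order all_algebra.
From mathcomp Require Import reals.
From mathcomp Require Import zify ring lra.

Set Implicit Arguments.
Unset Strict Implicit.
Unset Printing Implicit Defensive.

Import Order.TTheory GRing.Theory Num.Theory.

(* [tuple] also exports a [tsize]. *)
Local Notation tsize := Defs.tsize.

(** * Values and costs *)

Fixpoint value (env : seq tree) (e : expr) : tree :=
  match e with
  | EVar i => nth Leaf env i
  | ELeaf => Leaf
  | ENode a b => Node (value env a) (value env b)
  | ELet a b => value (value env a :: env) b
  | ECase a b c =>
      if value env a is Node h t then value [:: h, t & env] c else value env b
  | EFold l a f =>
      tfoldl (fun h acc => value [:: h, acc & env] f) (value env l) (value env a)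
  end.

Fixpoint work (env : seq tree) (e : expr) : nat :=
  tsize (value env e) +
  match e with
  | EVar _ => 0
  | ELeaf => 0
  | ENode a b => work env a + work env b
  | ELet a b => work env a + work (value env a :: env) b
  | ECase a b c =>
      work env a +
      (if value env a is Node h t then work [:: h, t & env] c else work env b)
  | EFold l a f =>
      (tfoldl (fun h acc => (value [:: h, acc.1 & env] f,
                             acc.2 + work [:: h, acc.1 & env] f))
         (value env l) (value env a, work env l + work env a)).2
  end.

Lemma tfoldl_ext (A : Type) (f g : tree -> A -> A) l a :
  (forall h b, f h b = g h b) -> tfoldl f l a = tfoldl g l a.
Proof. by move=> fg; elim: l a => //= h _ t IHt a; rewrite fg IHt. Qed.

Lemma tfoldl_fst (A B : Type) (g : tree -> A -> A) (c : tree -> A -> B -> B) l ab :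
  (tfoldl (fun h acc => (g h acc.1, c h acc.1 acc.2)) l ab).1 = tfoldl g l ab.1.
Proof. by elim: l ab => //= h _ t IHt ab; rewrite IHt. Qed.

Lemma execE env e : exec env e = (value env e, work env e).
Proof.
elim: e env => [i||a IHa b IHb|a IHa b IHb|a IHa b IHb c IHc|l IHl a IHa f IHf] env //=.
- by rewrite IHa IHb.
- by rewrite IHa IHb.
- by rewrite IHa; case: (value env a) => [|h t]; rewrite ?IHb ?IHc.
rewrite IHl IHa.
rewrite (tfoldl_ext (g := fun h acc => (value [:: h, acc.1 & env] f,
  (acc.2 + work [:: h, acc.1 & env] f)%N))) => [|h acc]; last by rewrite IHf.
rewrite /charge (tfoldl_fst (fun h acc => value [:: h, acc & env] f)
  (fun h acc n => (n + work [:: h, acc & env] f)%N)).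
by [].
Qed.

Lemma tsize_value env e : tsize (value env e) <= work env e.
Proof. by case: e => *; exact: leq_addr. Qed.

Lemma tsize_gt0 t : 0 < tsize t.
Proof. by case: t. Qed.

Fixpoint eclosed (n : nat) (e : expr) : bool :=
  match e with
  | EVar i => i < n
  | ELeaf => true
  | ENode a b => eclosed n a && eclosed n b
  | ELet a b => eclosed n a && eclosed n.+1 b
  | ECase a b c => [&& eclosed n a, eclosed n b & eclosed n.+2 c]
  | EFold l a f => [&& eclosed n l, eclosed n a & eclosed n.+2 f]
  end.

Lemma exec_closed e env env' :
  eclosed (size env) e -> exec (env ++ env') e = exec env e.
Proof.
elim: e env => [i||a IHa b IHb|a IHa b IHb|a IHa b IHb c IHc|l IHl a IHa f IHf] env //=.
- by move=> lt_i; rewrite nth_cat lt_i.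
- by case/andP=> ca cb; rewrite IHa // IHb.
- case/andP=> ca cb; rewrite IHa //; case: (exec env a) => va na.
  by rewrite -cat_cons IHb.
- case/and3P=> ca cb cc; rewrite IHa //; case: (exec env a) => [[|h t] na].
    by rewrite IHb.
  by rewrite -!cat_cons IHc.
- case/and3P=> cl ca cf; rewrite IHl // IHa //.
  case: (exec env l) => vl nl; case: (exec env a) => va na.
  congr (charge _); apply: tfoldl_ext => h acc.
  by rewrite -!cat_cons IHf.
Qed.

Lemma work_closed e env env' :
  eclosed (size env) e -> work (env ++ env') e = work env e.
Proof. by move=> /exec_closed E; have := E env'; rewrite !execE => -[]. Qed.

Fixpoint tall (P : tree -> Prop) (l : tree) : Prop :=
  if l is Node h t then P h /\ tall P t else True.

Fixpoint tlen (l : tree) : nat := if l is Node _ t then (tlen t).+1 else 0.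

Lemma tallT (P : tree -> Prop) l : (forall h, P h) -> tall P l.
Proof. by move=> PT; elim: l. Qed.

Lemma tall_sub (P Q : tree -> Prop) l :
  (forall h, P h -> Q h) -> tall P l -> tall Q l.
Proof. by move=> PQ; elim: l => //= h _ t IHt [/PQ Qh /IHt]. Qed.

Lemma tallI (P Q : tree -> Prop) l :
  tall P l -> tall Q l -> tall (fun h => P h /\ Q h) l.
Proof. by elim: l => //= h _ t IHt [Ph Pt] [Qh Qt]; split=> //; apply: IHt. Qed.

Lemma tlen_tsize l : tlen l <= tsize l.
Proof. by elim: l => //= h _ t; lia. Qed.

Lemma tall_tsize l : tall (fun h => tsize h <= tsize l) l.
Proof.
elim: l => //= h _ t IHt; split; first lia.
by apply: tall_sub IHt => h' /=; lia.
Qed.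

Lemma tfoldl_work_le (g : tree -> tree -> tree) (c : tree -> tree -> nat)
    (P : tree -> Prop) l v n A G S :
  tall P l -> tsize v + tlen l * G <= A ->
  (forall h acc, P h -> tsize acc <= A ->
     tsize (g h acc) <= tsize acc + G /\ c h acc <= S) ->
  let r := tfoldl (fun h acc => (g h acc.1, acc.2 + c h acc.1)) l (v, n) in
  tsize r.1 <= A /\ r.2 <= n + tlen l * S.
Proof.
move=> + + step; elim: l v n => [|h _ t IHt] v n /=; first by lia.
move=> [Ph Pt] le_v; have [|growth le_c] := step h v Ph; first by lia.
have [|size_r work_r] := IHt (g h v) (n + c h v) Pt; first by lia.
by split=> //; lia.
Qed.

Lemma work_fold env l a f (P : tree -> Prop) G S :
  tall P (value env l) ->
  (forall h acc, P h -> tsize acc <= tsize (value env a) + tsize (value env l) * G ->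
     tsize (value [:: h, acc & env] f) <= tsize acc + G
     /\ work [:: h, acc & env] f <= S) ->
  work env (EFold l a f)
    <= tsize (value env a) + tsize (value env l) * G
       + (work env l + work env a + tsize (value env l) * S).
Proof.
move=> Pl step; have le_len := tlen_tsize (value env l).
have le_A : tsize (value env a) + tlen (value env l) * G
    <= tsize (value env a) + tsize (value env l) * G.
  by rewrite leq_add2l leq_mul2r le_len orbT.
have [] := tfoldl_work_le (g := fun h acc => value [:: h, acc & env] f)
  (c := fun h acc => work [:: h, acc & env] f) (work env l + work env a) Pl le_A step.
rewrite (tfoldl_fst (fun h acc => value [:: h, acc & env] f)
  (fun h acc n => n + work [:: h, acc & env] f)) => size_r work_r.
apply: leq_add => //; apply: leq_trans work_r _.
by rewrite leq_add2l leq_mul2r le_len orbT.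
Qed.

Lemma work_var env i : work env (EVar i) = tsize (nth Leaf env i).
Proof. exact: addn0. Qed.

Lemma work_node env a b :
  work env (ENode a b) = tsize (Node (value env a) (value env b)) + (work env a + work env b).
Proof. by []. Qed.

Lemma work_let env a b :
  work env (ELet a b) = tsize (value (value env a :: env) b)
    + (work env a + work (value env a :: env) b).
Proof. by []. Qed.

Lemma work_case env a b c :
  work env (ECase a b c) = work env a
    + (if value env a is Node h t then tsize (value [:: h, t & env] c) + work [:: h, t & env] c
       else tsize (value env b) + work env b).
Proof.
rewrite [LHS]/=; case: (value env a) => [|h t]; exact: addnCA.
Qed.

(* Unification would otherwise run the interpreter. *)
#[local] Opaque work.

(** * Polynomial time *)

Lemma leq_wexp2r m n e : m <= n -> m ^ e <= n ^ e.
Proof. by case: e => // e le_mn; rewrite leq_exp2r. Qed.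

(* The offset makes the size an upper bound for 2, so that constants and sums stay
   below a power of it. *)
Definition env_size (env : seq tree) : nat := (\sum_(t <- env) tsize t).+2.

Lemma env_size_cons t env : env_size (t :: env) = tsize t + env_size env.
Proof. by rewrite /env_size big_cons !addnS. Qed.

Lemma env_size_gt1 env : 1 < env_size env.
Proof. by []. Qed.

Lemma tsize_nth_env env i : tsize (nth Leaf env i) <= env_size env.
Proof.
elim: env i => [|t env IHenv] [|i] //=; rewrite env_size_cons ?leq_addr //.
by apply: leq_trans (IHenv i) _; exact: leq_addl.
Qed.

(* The environments are restricted to [D] because an expression that reads only
   finitely many inputs costs a constant, see [polytime_closed]. *)
Definition poly_bounded (D : seq tree -> Prop) (g : seq tree -> nat) : Prop :=
  exists d, forall env, D env -> g env <= env_size env ^ d.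

Definition polytime (D : seq tree -> Prop) (e : expr) : Prop :=
  poly_bounded D (work^~ e).

Section PolyBounded.

Variable D : seq tree -> Prop.

Lemma poly_bounded_le g g' :
  (forall env, D env -> g env <= g' env) -> poly_bounded D g' -> poly_bounded D g.
Proof.
by move=> le_g [d le_d]; exists d => env Denv; exact: leq_trans (le_g _ Denv) (le_d _ Denv).
Qed.

Lemma poly_bounded_const c : poly_bounded D (fun=> c).
Proof.
exists c => env _; apply: leq_trans (ltnW (ltn_expl c (isT : 1 < 2))) _.
exact: leq_wexp2r.
Qed.

Lemma poly_bounded_add g g' :
  poly_bounded D g -> poly_bounded D g' -> poly_bounded D (fun env => g env + g' env).
Proof.
move=> [d le_d] [d' le_d']; exists (d + d').+1 => env Denv.
have n1 := ltnW (env_size_gt1 env); apply: (@leq_trans (2 * env_size env ^ (d + d'))).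
  rewrite mul2n -addnn; apply: leq_add.
    by apply: leq_trans (le_d _ Denv) _; rewrite leq_pexp2l ?leq_addr.
  by apply: leq_trans (le_d' _ Denv) _; rewrite leq_pexp2l ?leq_addl.
by rewrite expnS leq_mul2r env_size_gt1 orbT.
Qed.

Lemma poly_bounded_mul g g' :
  poly_bounded D g -> poly_bounded D g' -> poly_bounded D (fun env => g env * g' env).
Proof.
move=> [d le_d] [d' le_d']; exists (d + d') => env Denv.
by rewrite expnD; apply: leq_mul; [exact: le_d | exact: le_d'].
Qed.

Lemma poly_bounded_exp g c : poly_bounded D g -> poly_bounded D (fun env => g env ^ c).
Proof.
move=> [d le_d]; exists (d * c) => env Denv; rewrite expnM.
exact/leq_wexp2r/le_d.
Qed.

Lemma poly_bounded_env_size : poly_bounded D env_size.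
Proof. by exists 1 => env _; rewrite expn1. Qed.

Lemma poly_bounded_nth i : poly_bounded D (fun env => tsize (nth Leaf env i)).
Proof. by exists 1 => env _; rewrite expn1 tsize_nth_env. Qed.

Lemma poly_bounded_value e : polytime D e -> poly_bounded D (fun env => tsize (value env e)).
Proof. by apply: poly_bounded_le => env _; exact: tsize_value. Qed.

Lemma poly_bounded_comp (D' : seq tree -> Prop) (g : seq tree -> nat)
    (F : seq tree -> seq tree) :
  (forall env, D env -> D' (F env)) ->
  poly_bounded D (fun env => env_size (F env)) -> poly_bounded D' g ->
  poly_bounded D (fun env => g (F env)).
Proof.
move=> DF [d le_d] [d' le_d']; exists (d * d') => env Denv.
apply: leq_trans (le_d' _ (DF _ Denv)) _; rewrite expnM.
exact/leq_wexp2r/le_d.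
Qed.

End PolyBounded.

Ltac bound_poly :=
  lazymatch goal with
  | |- poly_bounded _ (fun=> ?c) => exact: poly_bounded_const
  | |- poly_bounded _ (fun env => tsize (nth Leaf env _)) => exact: poly_bounded_nth
  | |- poly_bounded _ (fun env => tsize (value env ?e)) =>
      apply: (@poly_bounded_value _ e); assumption
  | |- poly_bounded _ (fun env => env_size env) => exact: poly_bounded_env_size
  | |- poly_bounded _ (fun env => addn (@?g env) (@?g' env)) =>
      apply: (@poly_bounded_add _ g g'); bound_poly
  | |- poly_bounded _ (fun env => muln (@?g env) (@?g' env)) =>
      apply: (@poly_bounded_mul _ g g'); bound_poly
  | |- poly_bounded _ (fun env => expn (@?g env) ?c) =>
      apply: (@poly_bounded_exp _ g c); bound_poly
  | |- poly_bounded _ (fun env => S (@?g env)) =>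
      apply: (@poly_bounded_add _ (fun=> 1) g); bound_poly
  | |- _ => assumption
  end.

Section Polytime.

Variable D : seq tree -> Prop.

Lemma polytime_var i : polytime D (EVar i).
Proof.
apply: (poly_bounded_le (g' := fun env => tsize (nth Leaf env i))); last by bound_poly.
by move=> env _; rewrite work_var.
Qed.

Lemma polytime_leaf : polytime D ELeaf.
Proof. exact: (poly_bounded_const D 1). Qed.

Lemma polytime_node a b : polytime D a -> polytime D b -> polytime D (ENode a b).
Proof.
move=> poly_a poly_b; apply: (poly_bounded_le (g' := fun env =>
  1 + (tsize (value env a) + tsize (value env b)) + (work env a + work env b))).
  by move=> env _; rewrite work_node.
by bound_poly.
Qed.

Lemma polytime_let (D' : seq tree -> Prop) a b :
  (forall env, D env -> D' (value env a :: env)) ->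
  polytime D a -> polytime D' b -> polytime D (ELet a b).
Proof.
move=> DD' poly_a poly_b; apply: (poly_bounded_le (g' := fun env =>
  work env a + 2 * work (value env a :: env) b)).
  by move=> env _; have := tsize_value (value env a :: env) b; rewrite work_let; lia.
have : poly_bounded D (fun env => work (value env a :: env) b).
  apply: (poly_bounded_comp (F := fun env => value env a :: env) (g := work^~ b)) poly_b => //.
  apply: (poly_bounded_le (g' := fun env => tsize (value env a) + env_size env)) => [env _|].
    by rewrite env_size_cons.
  by bound_poly.
by move=> poly_b'; bound_poly.
Qed.

Lemma polytime_case (D' : seq tree -> Prop) a b c :
  (forall env h t, D env -> value env a = Node h t -> D' [:: h, t & env]) ->
  polytime D a -> polytime D b -> polytime D' c -> polytime D (ECase a b c).
Proof.
move=> DD' poly_a poly_b [d le_d].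
pose branch env := if value env a is Node h t then work [:: h, t & env] c else 0.
have poly_c : poly_bounded D branch.
  apply: (poly_bounded_le (g' := fun env => (tsize (value env a) + env_size env) ^ d)).
    move=> env Denv; rewrite /branch; case Ea: (value env a) => [|h t] //.
    apply: leq_trans (le_d _ (DD' _ _ _ Denv Ea)) _; apply: leq_wexp2r.
    by rewrite !env_size_cons /=; lia.
  by bound_poly.
apply: (poly_bounded_le (g' := fun env => work env a + 2 * (work env b + branch env))).
  move=> env _; rewrite /branch work_case.
  case: (value env a) => [|h t]; first by have := tsize_value env b; lia.
  by have := tsize_value [:: h, t & env] c; lia.
by bound_poly.
Qed.

Lemma polytime_fold (D' : seq tree -> Prop) G l a f :
  (forall env, D env -> tall (fun h => forall acc, D' [:: h, acc & env]) (value env l)) ->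
  (forall env h acc, D' [:: h, acc & env] ->
     tsize (value [:: h, acc & env] f) <= tsize acc + G (h :: env)) ->
  poly_bounded (fun=> True) G ->
  polytime D l -> polytime D a -> polytime D' f -> polytime D (EFold l a f).
Proof.
move=> DD' growth [dG le_G] poly_l poly_a [d le_d].
pose n env := tsize (value env l) + env_size env.
pose A env := tsize (value env a) + tsize (value env l) * n env ^ dG.
apply: (poly_bounded_le (g' := fun env => A env + (work env l + work env a
  + tsize (value env l) * (n env + A env) ^ d))).
  move=> env Denv; apply: work_fold (tallI (DD' _ Denv) (tall_tsize _)) _.
  move=> h acc [D'h le_h] le_acc; split.
    apply: leq_trans (growth _ _ _ (D'h acc)) _; rewrite leq_add2l.
    apply: leq_trans (le_G _ I) _; apply: leq_wexp2r.
    by rewrite env_size_cons leq_add2r.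
  apply: leq_trans (le_d _ (D'h acc)) _; apply: leq_wexp2r.
  by rewrite !env_size_cons /n; move: le_acc le_h; rewrite -/(A env); lia.
by rewrite /A /n; bound_poly.
Qed.

Lemma polytime_closed (J : finType) (E : J -> seq tree) e :
  (forall j, eclosed (size (E j)) e) ->
  (forall env, D env -> exists j env', env = E j ++ env') -> polytime D e.
Proof.
move=> closed_e DE; apply: (poly_bounded_le (g' := fun=> \sum_j work (E j) e)).
  move=> _ /DE [j [env' ->]]; rewrite work_closed //.
  by rewrite (bigD1 j) //=; exact: leq_addr.
by bound_poly.
Qed.

End Polytime.

(** * The reduction as a program *)

Definition Elit n := iter n (ENode ELeaf) ELeaf.
Definition Ehead l := ECase l ELeaf (EVar 0).
Definition Etail l := ECase l ELeaf (EVar 1).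
Definition Edrop j l := iter j Etail l.
Definition Eproj j l := Ehead (Edrop j l).
Definition Enth i l := Ehead (EFold i l (Etail (EVar 1))).
Definition Enot a := ECase a (Elit 1) ELeaf.
Definition Eodd a := EFold a ELeaf (Enot (EVar 1)).
Definition Eadd a b := EFold a b (ENode ELeaf (EVar 1)).
Definition Esub a b := EFold b a (Etail (EVar 1)).
Definition Edist a b := Eadd (Esub a b) (Esub b a).

Definition Emuladd i n v :=
  ELet (ENode i (ENode n v))
    (EFold (Eproj 0 (EVar 0)) (Edrop 2 (EVar 0)) (Eadd (Eproj 1 (EVar 2)) (EVar 1))).

Definition Erange n :=
  EFold n ELeaf
    (ENode (ECase (EVar 1) ELeaf (ENode ELeaf (EVar 0))) (EVar 1)).

Definition Ewords n A :=
  ELet (ENode n A)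
    (EFold (Eproj 0 (EVar 0)) (ENode ELeaf ELeaf)
      (EFold (EVar 1) ELeaf
        (EFold (Edrop 1 (EVar 4)) (EVar 1)
          (ENode (ENode (EVar 0) (EVar 2)) (EVar 1))))).

(* [bit] computes the bit at the position given by variable 0; variable 1 is the
   accumulator. *)
Definition Epoint k bit c :=
  EFold (Erange k) c (Eadd (EVar 1) (Eadd (EVar 1) bit)).

Definition Ecollisions c :=
  let eq i j := Enot (Edist (Enth (Elit i) c) (Enth (Elit j) c)) in
  Eadd (eq 0 1) (Eadd (eq 0 2) (Eadd (eq 0 3)
    (Eadd (eq 1 2) (Eadd (eq 1 3) (eq 2 3))))).

Definition Eeqn v1 v2 v3 v4 b := ENode (ENode v1 (ENode v2 (ENode v3 (ENode v4 ELeaf)))) b.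

(* The position of the bit is variable 0. *)
Definition Ebit x := Enth (EVar 0) (EVar x).

Definition Eshifted_bit p z w x b :=
  Eodd (Eadd (Ebit x) (Eadd (Enth (Enth (EVar 0) p) (EVar z)) (Eadd b (Enot (Ebit w))))).

(* Variables, from the inside out: c, y, x, w', w, z, b, each followed by an
   accumulator, then the argument (p, p', k, s, q) of [Etemplates]; [Epoint]
   evaluates the bits under two more variables. *)
Definition Etemplate :=
  let query bit j := Epoint (Eproj 2 (EVar 14)) bit (Enth (Elit j) (EVar 0)) in
  ECase (Ecollisions (EVar 0))
    (ENode
      (Eeqn (query (Ebit 6) 0)
        (query (Eshifted_bit (Eproj 0 (EVar 16)) 12 10 6 (EVar 14)) 1)
        (query (Ebit 4) 2)
        (query (Eshifted_bit (Eproj 1 (EVar 16)) 12 8 4 ELeaf) 3)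
        (EVar 12))
      (EVar 1))
    (EVar 3).

Definition Etemplates :=
  let bits := Erange (Elit 2) in
  EFold bits ELeaf
  (EFold (Ewords (Eproj 3 (EVar 2)) bits) (EVar 1)
  (EFold (Ewords (Eproj 2 (EVar 4)) (Erange (Edrop 4 (EVar 4)))) (EVar 1)
  (EFold (Ewords (Eproj 2 (EVar 6)) (Erange (Edrop 4 (EVar 6)))) (EVar 1)
  (EFold (Ewords (Eproj 2 (EVar 8)) bits) (EVar 1)
  (EFold (Ewords (Eproj 2 (EVar 10)) bits) (EVar 1)
  (EFold (Ewords (Elit 4) (Erange (Eproj 3 (EVar 12)))) (EVar 1)
    Etemplate)))))).

(* The argument is the pair (k, s). *)
Definition Ewidth :=
  EFold (Ehead (EVar 0)) (Edrop 1 (EVar 0)) (Eadd (EVar 1) (EVar 1)).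

(* Variables: template, accumulator, edge e', accumulator, edge e, accumulator, q,
   instance. *)
Definition Eglobalize :=
  let var j e := Emuladd (Enth (Elit j) (Ehead (EVar 0))) (Eproj 1 (EVar 7)) (Eproj 1 (EVar e)) in
  Eeqn (var 0 4) (var 1 4) (var 2 2) (var 3 2) (Etail (EVar 0)).

Definition Epair_eqns :=
  ECase (Edist (Eproj 0 (EVar 0)) (Eproj 0 (EVar 2)))
    (EFold
      (ELet (ENode (Edrop 2 (EVar 2)) (ENode (Edrop 2 (EVar 0))
              (ENode (Eproj 2 (EVar 5)) (ENode (Eproj 3 (EVar 5)) (EVar 4)))))
         Etemplates)
      (EVar 1)
      (ENode Eglobalize (EVar 1)))
    (EVar 3).

(* Variables: edge e, accumulator, q, instance. *)
Definition Eedge_eqns := EFold (Edrop 4 (EVar 3)) (EVar 1) Epair_eqns.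

(* Variables: q, instance. *)
Definition Envar :=
  Emuladd (ELet (ENode (Eproj 2 (EVar 1)) (Eproj 3 (EVar 1))) Ewidth) (Eproj 1 (EVar 1)) ELeaf.

Definition reduction (q : nat) : expr :=
  ELet (Elit q) (ENode Envar (EFold (Edrop 4 (EVar 1)) ELeaf Eedge_eqns)).

(** * Correctness of the program *)

Local Notation enc_word := (enc_seq enc_nat).

Lemma value_iter (U : Type) (encU : U -> tree) env l a f n g (u : U) :
  value env l = enc_nat n -> value env a = encU u ->
  (forall u', value [:: Leaf, encU u' & env] f = encU (g u')) ->
  value env (EFold l a f) = encU (iter n g u).
Proof. by move=> /= -> -> step; elim: n u => //= n IHn u; rewrite step IHn -iterSr. Qed.

Lemma value_foldl (T : eqType) (U : Type) (encT : T -> tree) (encU : U -> tree)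
    env l a f s g (u : U) :
  value env l = enc_seq encT s -> value env a = encU u ->
  (forall x u', x \in s -> value [:: encT x, encU u' & env] f = encU (g u' x)) ->
  value env (EFold l a f) = encU (foldl g u s).
Proof.
move=> /= -> ->; elim: s u => //= x s IHs u step.
by rewrite step ?mem_head // IHs // => y u' ys; apply: step; rewrite inE ys orbT.
Qed.

Lemma eq_enc_seq (T : Type) (enc enc' : T -> tree) s :
  enc =1 enc' -> enc_seq enc s = enc_seq enc' s.
Proof. by move=> eq_enc; elim: s => //= x s ->; rewrite eq_enc. Qed.

Lemma enc_seq_map (T U : Type) (enc : U -> tree) (f : T -> U) l :
  enc_seq (fun x => enc (f x)) l = enc_seq enc [seq f x | x <- l].
Proof. by elim: l => //= x l ->. Qed.

(* [push enc s] prepends the items of [s] one after the other: this is what a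
   loop collecting [s] does to its accumulator. *)
Definition push (T : Type) (enc : T -> tree) (s : seq T) (t : tree) : tree :=
  foldl (fun t x => Node (enc x) t) t s.

Lemma push_cat (T : Type) (enc : T -> tree) s1 s2 t :
  push enc (s1 ++ s2) t = push enc s2 (push enc s1 t).
Proof. exact: foldl_cat. Qed.

Lemma push_leaf (T : Type) (enc : T -> tree) s : push enc s Leaf = enc_seq enc (rev s).
Proof.
rewrite /rev -[Leaf]/(enc_seq enc [::]).
by elim: s [::] => //= x s IHs o; rewrite -IHs.
Qed.

Lemma bigcat_flatten (I T : Type) (s : seq I) (F : I -> seq T) :
  \big[cat/[::]]_(i <- s) F i = flatten [seq F i | i <- s].
Proof. by rewrite /flatten foldrE big_map. Qed.

Lemma value_collect (T : eqType) (U : Type) (encT : T -> tree) (encU : U -> tree)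
    env l a f (s : seq T) (G : T -> seq U) :
  value env l = enc_seq encT s ->
  (forall x t, x \in s -> value [:: encT x, t & env] f = push encU (G x) t) ->
  value env (EFold l a f)
    = push encU (\big[cat/[::]]_(x <- s) G x) (value env a).
Proof.
move=> El step; rewrite (value_foldl (encU := id) El (erefl _) step).
elim: s (value env a) {El step} => [|x s IHs] t; first by rewrite big_nil.
by rewrite big_cons push_cat /= IHs.
Qed.

Lemma value_map (T : eqType) (U : Type) (encT : T -> tree) (encU : U -> tree)
    env l a f (s : seq T) (g : T -> U) :
  value env l = enc_seq encT s ->
  (forall x t, value [:: encT x, t & env] f = Node (encU (g x)) t) ->
  value env (EFold l a f) = push encU [seq g x | x <- s] (value env a).
Proof.
move=> El step; rewrite (@value_collect _ _ encT encU _ _ _ _ s (fun x => [:: g x])) //.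
by rewrite bigcat_flatten flatten_map1.
Qed.

Lemma value_node env a b : value env (ENode a b) = Node (value env a) (value env b).
Proof. by []. Qed.

Lemma value_case_leaf env a b c :
  value env a = Leaf -> value env (ECase a b c) = value env b.
Proof. by move=> /= ->. Qed.

Lemma value_case_node env a b c h t :
  value env a = Node h t -> value env (ECase a b c) = value [:: h, t & env] c.
Proof. by move=> /= ->. Qed.

Lemma value_let env a b t : value env a = t -> value env (ELet a b) = value (t :: env) b.
Proof. by move=> <-. Qed.

Definition range (n : nat) : seq nat := rev (iota 0 n).

Lemma rangeS n : range n.+1 = n :: range n.
Proof. by rewrite /range -addn1 iotaD cats1 rev_rcons. Qed.

Definition words (n : nat) (A : seq nat) : seq (seq nat) :=
  iter n (fun W => rev [seq a :: w | w <- W, a <- A]) [:: [::]].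

(* The number with binary digits [c f(k-1) ... f(0)], where [c] is not reduced. *)
Definition point (k : nat) (f : nat -> nat) (c : nat) : nat :=
  foldl (fun a i => a + (a + f i)) c (range k).

Lemma value_lit env n : value env (Elit n) = enc_nat n.
Proof. by rewrite /Elit; elim: n => //= n ->. Qed.

Lemma value_not env a n : value env a = enc_nat n -> value env (Enot a) = enc_nat (n == 0).
Proof. by move=> /= ->; case: n. Qed.

Lemma value_odd env a n : value env a = enc_nat n -> value env (Eodd a) = enc_nat (odd n).
Proof.
by move=> Ea; apply: (value_iter (encU := enc_nat \o nat_of_bool) (u := false) Ea) => [|[]].
Qed.

Lemma value_add env a b x y : value env a = enc_nat x -> value env b = enc_nat y ->
  value env (Eadd a b) = enc_nat (x + y).
Proof. by move=> Ea Eb; rewrite addnC -iter_succn; apply: (value_iter Ea Eb). Qed.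

Lemma value_sub env a b x y : value env a = enc_nat x -> value env b = enc_nat y ->
  value env (Esub a b) = enc_nat (x - y).
Proof.
by move=> Ea Eb; rewrite -iter_predn; apply: (value_iter Eb Ea) => -[].
Qed.

Lemma value_dist env a b x y : value env a = enc_nat x -> value env b = enc_nat y ->
  value env (Edist a b) = enc_nat ((x - y) + (y - x)).
Proof. by move=> Ea Eb; apply: value_add; apply: value_sub. Qed.

Lemma value_nth env i l n s : value env i = enc_nat n -> value env l = enc_word s ->
  value env (Enth i l) = enc_nat (nth 0 s n).
Proof.
move=> Ei El; rewrite /Enth /Ehead (lock EFold) /= -lock.
rewrite (value_iter (g := behead) Ei El) => [|[]//].
have -> : iter n behead s = drop n s.
  by elim: {Ei} n s {El} => [|n IHn] [|x s] //=; rewrite -iterS iterSr ?IHn.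
by rewrite -[n in RHS]addn0 -nth_drop; case: (drop n s).
Qed.

Lemma value_muladd env i n v x y z : value env i = enc_nat x -> value env n = enc_nat y ->
  value env v = enc_nat z -> value env (Emuladd i n v) = enc_nat (x * y + z).
Proof.
move=> Ei En Ev; rewrite (value_let _ (t := Node (enc_nat x) (Node (enc_nat y) (enc_nat z)))).
  rewrite mulnC -iter_addn; apply: value_iter; [by []|by []|move=> u].
  exact: value_add.
by rewrite /= Ei En Ev.
Qed.

Lemma value_range env a n : value env a = enc_nat n -> value env (Erange a) = enc_word (range n).
Proof.
move=> Ea; pose next r := (if r is x :: _ then x.+1 else 0) :: r.
rewrite (value_iter (encU := enc_word) (g := next) (u := [::]) Ea) => [|//|[]//].
congr (enc_seq _); elim: {Ea} n => // n IHn; rewrite iterS IHn rangeS.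
by case: n {IHn} => // n; rewrite rangeS.
Qed.

Lemma value_words env n A x s : value env n = enc_nat x -> value env A = enc_word s ->
  value env (Ewords n A) = enc_seq enc_word (words x s).
Proof.
move=> En EA; rewrite (value_let _ (t := Node (enc_nat x) (enc_word s))).
  apply: (value_iter (encU := enc_seq enc_word)); [by []|by []|move=> W].
  rewrite -push_leaf -bigcat_flatten.
  apply: (value_collect (encT := enc_word)) => [//|w t _].
  exact: (value_map (encT := enc_nat)).
by rewrite /= En EA.
Qed.

Lemma value_point env k bit c n (f : nat -> nat) x :
  value env k = enc_nat n -> value env c = enc_nat x ->
  (forall i a, value [:: enc_nat i, enc_nat a & env] bit = enc_nat (f i)) ->
  value env (Epoint k bit c) = enc_nat (point n f x).
Proof.
move=> /value_range Ek Ec Ebit; apply: (value_foldl Ek Ec) => i a _.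
by do !apply: value_add => //; exact: Ebit.
Qed.

Definition raw_eqn : Type := (seq nat * nat)%type.

Definition enc_raw (r : raw_eqn) : tree := Node (enc_word r.1) (enc_nat r.2).

Lemma value_eqn env e1 e2 e3 e4 eb v1 v2 v3 v4 b :
  value env e1 = enc_nat v1 -> value env e2 = enc_nat v2 ->
  value env e3 = enc_nat v3 -> value env e4 = enc_nat v4 ->
  value env eb = enc_nat b ->
  value env (Eeqn e1 e2 e3 e4 eb) = enc_raw ([:: v1; v2; v3; v4], b).
Proof. by move=> /= -> -> -> -> ->. Qed.

Definition shifted_bit (p z w x : seq nat) (b i : nat) : nat :=
  odd (nth 0 x i + (nth 0 z (nth 0 p i) + (b + (nth 0 w i == 0)))).

Definition template k p p' b z w w' x y c : raw_eqn :=
  ([:: point k (nth 0 x) (nth 0 c 0); point k (shifted_bit p z w x b) (nth 0 c 1);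
       point k (nth 0 y) (nth 0 c 2); point k (shifted_bit p' z w' y 0) (nth 0 c 3)], b).

Definition templates k s q p p' : seq raw_eqn :=
  \big[cat/[::]]_(b <- range 2) \big[cat/[::]]_(z <- words s (range 2))
  \big[cat/[::]]_(w <- words k (range q)) \big[cat/[::]]_(w' <- words k (range q))
  \big[cat/[::]]_(x <- words k (range 2)) \big[cat/[::]]_(y <- words k (range 2))
  \big[cat/[::]]_(c <- words 4 (range s) | uniq c) [:: template k p p' b z w w' x y c].

Lemma mem_words n A w : (w \in words n A) = (size w == n) && all (mem A) w.
Proof.
rewrite /words; elim: n w => [|n IHn] w; first by case: w.
rewrite iterS mem_rev; apply/allpairsP/idP => [[[w' a] [/= + aA ->]]|].
  by rewrite IHn => /andP [/eqP <- w'A]; rewrite /= eqxx aA.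
by case: w => // a w /and3P [sw aA wA]; exists (w, a); rewrite IHn; split=> //; apply/andP.
Qed.

Lemma words_uniq n A : uniq A -> uniq (words n A).
Proof.
move=> uA; elim: n => // n IHn; rewrite /words iterS rev_uniq.
by apply: allpairs_uniq => // -[w a] [w' a'] _ _ [-> ->].
Qed.

Lemma value_collisions env c s : size s = 4 -> value env c = enc_word s ->
  exists2 n, value env (Ecollisions c) = enc_nat n & (n == 0) = uniq s.
Proof.
case: s => [|s0 [|s1 [|s2 [|s3 []]]]] // _ Ec.
have nth_c j : value env (Enth (Elit j) c) = enc_nat (nth 0 [:: s0; s1; s2; s3] j).
  exact: value_nth (value_lit _ _) Ec.
eexists; first by do !first [apply: value_add | apply: value_not; apply: value_dist].
have dist_eq0 x y : (x - y + (y - x) == 0) = (x == y) by lia.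
by rewrite !dist_eq0 !addn_eq0 !eqb0 /= !inE !negb_or !andbT -!andbA.
Qed.

Definition enc_args (p p' : seq nat) (k s q : nat) : tree :=
  Node (enc_word p) (Node (enc_word p') (Node (enc_nat k) (Node (enc_nat s) (enc_nat q)))).

Lemma value_bit env x u i : nth Leaf env 0 = enc_nat i -> nth Leaf env x = enc_word u ->
  value env (Ebit x) = enc_nat (nth 0 u i).
Proof. by move=> Ei Ex; apply: value_nth. Qed.

Lemma value_shifted_bit env ep z w x eb i p zs ws xs b :
  nth Leaf env 0 = enc_nat i -> value env ep = enc_word p ->
  nth Leaf env z = enc_word zs -> nth Leaf env w = enc_word ws ->
  nth Leaf env x = enc_word xs -> value env eb = enc_nat b ->
  value env (Eshifted_bit ep z w x eb) = enc_nat (shifted_bit p zs ws xs b i).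
Proof.
move=> Ei Ep Ez Ew Ex Eb; apply: value_odd; apply: value_add; first exact: value_bit.
apply: value_add; first by apply: value_nth => //; apply: value_nth.
by apply: value_add => //; apply: value_not; exact: value_bit.
Qed.

Lemma value_template env p p' b z w w' x y c k s q t1 t2 t3 t4 t5 t6 t7 :
  size c = 4 ->
  value [:: enc_word c, t1, enc_word y, t2, enc_word x, t3, enc_word w', t4,
    enc_word w, t5, enc_word z, t6, enc_nat b, t7, enc_args p p' k s q & env] Etemplate
  = push enc_raw (if uniq c then [:: template k p p' b z w w' x y c] else [::]) t1.
Proof.
move=> size_c; rewrite /Etemplate; set env' := _ :: _.
have [n En <-] := @value_collisions env' (EVar 0) c size_c erefl.
case: n En => [|n] En; last by rewrite (value_case_node _ _ En).
rewrite (value_case_leaf _ _ En).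
have query bit f j :
    (forall i a, value [:: enc_nat i, enc_nat a & env'] bit = enc_nat (f i)) ->
    value env' (Epoint (Eproj 2 (EVar 14)) bit (Enth (Elit j) (EVar 0)))
      = enc_nat (point k f (nth 0 c j)).
  by move=> Ebits; apply: value_point => //; apply: value_nth; first exact: value_lit.
rewrite value_node; congr Node.
apply: value_eqn; last by []; apply: query => i a.
- exact: value_bit.
- exact: value_shifted_bit.
- exact: value_bit.
- exact: value_shifted_bit.
Qed.

Lemma value_templates env p p' k s q :
  value (enc_args p p' k s q :: env) Etemplates
    = enc_seq enc_raw (rev (templates k s q p p')).
Proof.
rewrite -push_leaf /Etemplates /templates.
apply: (value_collect (encT := enc_nat)) => [|b t1 _]; first exact/value_range/value_lit.
apply: (value_collect (encT := enc_word)) => [|z t2 _].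
  by apply: value_words; [|apply/value_range/value_lit].
apply: (value_collect (encT := enc_word)) => [|w t3 _].
  by apply: value_words; [|apply/value_range].
apply: (value_collect (encT := enc_word)) => [|w' t4 _].
  by apply: value_words; [|apply/value_range].
apply: (value_collect (encT := enc_word)) => [|x t5 _].
  by apply: value_words; [|apply/value_range/value_lit].
apply: (value_collect (encT := enc_word)) => [|y t6 _].
  by apply: value_words; [|apply/value_range/value_lit].
rewrite [in RHS]big_mkcond.
apply: (value_collect (encT := enc_word)) => [|c t7].
  by apply: value_words; [apply: value_lit|apply/value_range].
by rewrite mem_words => /andP [/eqP size_c _]; apply: value_template.
Qed.

Definition word (J : Type) (v : J -> nat) n (f : 'I_n -> J) : seq nat :=
  [seq v (f i) | i <- enum 'I_n].

Lemma size_word (J : Type) (v : J -> nat) n (f : 'I_n -> J) : size (word v f) = n.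
Proof. by rewrite size_map size_enum_ord. Qed.

Lemma nth_word (J : Type) (v : J -> nat) n (f : 'I_n -> J) (i : 'I_n) :
  nth 0 (word v f) i = v (f i).
Proof. by rewrite (nth_map i) ?nth_ord_enum // size_enum_ord. Qed.

Definition globalize (nV v v' : nat) (t : raw_eqn) : raw_eqn :=
  let var j x := nth 0 t.1 j * nV + x in
  ([:: var 0 v; var 1 v; var 2 v'; var 3 v'], t.2).

Section Reduction.

Variables (q k s : nat) (L : label_cover k s).

Local Notation edge := (lc_edge (lcU L) (lcV L) k s).

Definition pair_eqns (e e' : edge) : seq raw_eqn :=
  [seq globalize (lcV L) e.1.2 e'.1.2 t
    | t <- rev (templates k s q (word val e.2) (word val e'.2))].

Definition edge_eqns (e : edge) : seq raw_eqn :=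
  \big[cat/[::]]_(e' <- lcE L | e'.1.1 == e.1.1) pair_eqns e e'.

Definition raw_eqns : seq raw_eqn := rev (\big[cat/[::]]_(e <- lcE L) edge_eqns e).

Lemma enc_edgeE (e : edge) :
  enc_edge e = Node (enc_nat e.1.1) (Node (enc_nat e.1.2) (enc_word (word val e.2))).
Proof. by rewrite /enc_edge /word -enc_seq_map. Qed.

Lemma value_globalize env (e e' : edge) t :
  nth Leaf env 2 = enc_edge e' -> nth Leaf env 4 = enc_edge e -> nth Leaf env 7 = enc_lc L ->
  nth Leaf env 0 = enc_raw t ->
  value env Eglobalize
    = enc_raw (globalize (lcV L) e.1.2 e'.1.2 t).
Proof.
move=> Ee' Ee EL Et.
have var j x y : value env (Eproj 1 (EVar x)) = enc_nat y ->
    value env (Emuladd (Enth (Elit j) (Ehead (EVar 0))) (Eproj 1 (EVar 7)) (Eproj 1 (EVar x)))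
      = enc_nat (nth 0 t.1 j * lcV L + y).
  move=> Ey; apply: value_muladd Ey; last by rewrite /= EL.
  by apply: value_nth (value_lit _ _) _; rewrite /= Et.
apply: value_eqn; [apply: var|apply: var|apply: var|apply: var|].
all: by rewrite /= ?Ee ?Ee' ?Et ?enc_edgeE.
Qed.

Lemma value_pair_eqns e e' t t' env :
  value [:: enc_edge e', t', enc_edge e, t, enc_nat q, enc_lc L & env] Epair_eqns
  = push enc_raw (if e'.1.1 == e.1.1 then pair_eqns e e' else [::]) t'.
Proof.
rewrite /Epair_eqns; set env' := _ :: _.
have := @value_dist env' (Eproj 0 (EVar 0)) (Eproj 0 (EVar 2)) e'.1.1 e.1.1 erefl erefl.
have -> : (e'.1.1 == e.1.1) = (e'.1.1 - e.1.1 + (e.1.1 - e'.1.1) == 0).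
  by rewrite -val_eqE /=; lia.
case: (_ + _) => [|n] Ed; last by rewrite (value_case_node _ _ Ed).
rewrite (value_case_leaf _ _ Ed).
apply: (value_map (encT := enc_raw)) => [|r t1]; last first.
  by rewrite value_node; congr Node; exact: value_globalize.
rewrite (value_let _ (t := enc_args (word val e.2) (word val e'.2) k s q)).
  exact: value_templates.
by rewrite /= /enc_args /word -!enc_seq_map.
Qed.

Lemma value_edge_eqns e t :
  value [:: enc_edge e; t; enc_nat q; enc_lc L] Eedge_eqns = push enc_raw (edge_eqns e) t.
Proof.
rewrite /edge_eqns big_mkcond.
apply: (value_collect (encT := @enc_edge _ _ k s)) => // e' t' _.
exact: value_pair_eqns.
Qed.

Lemma value_width env n a :
  value (Node (enc_nat n) (enc_nat a) :: env) Ewidth = enc_nat (2 ^ n * a).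
Proof.
rewrite (value_iter (encU := enc_nat) (n := n) (g := fun u => u + u) (u := a)) //.
  by congr enc_nat; elim: n => [|n IHn]; rewrite ?mul1n // iterS IHn addnn -mul2n mulnA expnS.
by move=> u; apply: value_add.
Qed.

Lemma eval_reduction :
  eval (reduction q) (enc_lc L)
  = Node (enc_nat (2 ^ k * s * lcV L)) (enc_seq enc_raw raw_eqns).
Proof.
rewrite /eval execE [LHS](value_let _ (value_lit _ q)) value_node -push_leaf.
congr Node.
  rewrite -[2 ^ k * s * _]addn0; apply: value_muladd => //.
  exact: value_width.
apply: (value_collect (encT := @enc_edge _ _ k s)) => // e t _.
exact: value_edge_eqns.
Qed.

End Reduction.

(** * The equations *)

Local Notation cube n := {ffun 'I_n -> bool}.
Local Notation bits := (word nat_of_bool).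
Local Notation labels := (word (@nat_of_ord _)).

Lemma pointS n f c : point n.+1 f c = point n f (c + (c + f n)).
Proof. by rewrite /point rangeS. Qed.

Lemma eq_point n f g c : (forall i, i < n -> f i = g i) -> point n f c = point n g c.
Proof.
elim: n c => [|n IHn] c fg //; rewrite !pointS fg //.
by apply: IHn => i /ltnW; exact: fg.
Qed.

Lemma point_lt n f c : (forall i, f i < 2) -> point n f c < c.+1 * 2 ^ n.
Proof.
move=> f2; elim: n c => [|n IHn] c; first by rewrite muln1.
rewrite pointS; apply: leq_trans (IHn _) _; rewrite expnS mulnA leq_mul2r.
by have := f2 n; lia.
Qed.

Lemma point_inj n f g c d : (forall i, f i < 2) -> (forall i, g i < 2) ->
  point n f c = point n g d -> c = d /\ (forall i, i < n -> f i = g i).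
Proof.
move=> f2 g2; elim: n c d => [|n IHn] c d //; rewrite !pointS => /IHn [E fg].
have := f2 n; have := g2 n => ltg ltf; split; first lia.
by move=> i; rewrite ltnS leq_eqVlt => /predU1P [->|/fg //]; lia.
Qed.

Lemma nth_bits_lt2 n (x : cube n) i : nth 0 (bits x) i < 2.
Proof.
have [lt_i|le_n] := ltnP i n; last by rewrite nth_default ?size_word.
by rewrite (nth_word nat_of_bool x (Ordinal lt_i)) ltnS leq_b1.
Qed.

Section Variables.

Variables nV k s : nat.

Definition var_index (v : 'I_nV) (x : cube k) (c : 'I_s) : nat :=
  point k (nth 0 (bits x)) c * nV + v.

Lemma var_index_lt v x c : var_index v x c < 2 ^ k * s * nV.
Proof.
have := point_lt k c (nth_bits_lt2 x); have := ltn_ord c; have := ltn_ord v.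
rewrite /var_index; set i := point _ _ _ => lt_v lt_c lt_i.
have {lt_i} lt_i : i < 2 ^ k * s.
  by apply: leq_trans lt_i _; rewrite mulnC leq_mul2l lt_c orbT.
apply: (@leq_trans (i.+1 * nV)); first by rewrite mulSn addnC ltn_add2r.
by rewrite leq_mul2r lt_i orbT.
Qed.

Definition var v x c : 'I_(2 ^ k * s * nV) := Ordinal (var_index_lt v x c).

Lemma var_inj v x c v' x' c' :
  var v x c = var v' x' c' -> [/\ v = v', x = x' & c = c'].
Proof.
move=> /(congr1 val) /= E; have nV0 : 0 < nV by apply: leq_trans (ltn_ord v).
have Ev : v = v' by apply: val_inj; have := congr1 (modn^~ nV) E; rewrite !modnMDl !modn_small.
have := congr1 (divn^~ nV) E; rewrite !divnMDl // !divn_small // !addn0.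
case/(point_inj (nth_bits_lt2 x) (nth_bits_lt2 x')) => Ec Ex; split=> //; last exact: val_inj.
by apply/ffunP => i; have := Ex i (ltn_ord i); rewrite !nth_word => /(can_inj oddb).
Qed.

End Variables.

Section Test.

Variables k s q : nat.

Local Notation noise := {ffun 'I_k -> 'I_q}.
Local Notation copies := {ffun 'I_4 -> 'I_s}.

Definition coins : finType := (bool * cube s * noise * noise * cube k * cube k)%type.

Lemma card_coins_gt0 : 0 < q -> 0 < #|coins|.
Proof. by move=> q0; rewrite !card_prod !card_ffun !card_ord card_bool !muln_gt0 !expn_gt0 q0. Qed.

Definition shift (p : {ffun 'I_k -> 'I_s}) (z : cube s) (w : noise) (b : bool) : cube k :=
  [ffun i => z (p i) (+) (b (+) (w i == 0 :> nat))].

Definition test_points (T : Type) (v v' : T) (p p' : {ffun 'I_k -> 'I_s}) (r : coins) :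
    4.-tuple (T * cube k) :=
  let: (b, z, w, w', x, y) := r in
  [tuple (v, x); (v, x + shift p z w b)%R; (v', y); (v', y + shift p' z w' false)%R].

Definition test_sign (r : coins) : bool := let: (b, z, w, w', x, y) := r in b.

Definition raw_template (p p' : {ffun 'I_k -> 'I_s}) (r : coins) (c : copies) : raw_eqn :=
  let: (b, z, w, w', x, y) := r in
  template k (labels p) (labels p') b (bits z) (labels w) (labels w') (bits x) (bits y) (labels c).

Section Sums.

Variable V : nmodType.
Local Open Scope ring_scope.

Lemma big_bigcat (I T : Type) (s0 : seq I) (P : pred I) (G : I -> seq T) (F : T -> V) :
  \sum_(x <- \big[cat/[::]]_(i <- s0 | P i) G i) F x = \sum_(i <- s0 | P i) \sum_(x <- G i) F x.
Proof.
by apply: (big_morph (fun t => \sum_(x <- t) F x)) => [t t'|]; rewrite ?big_cat ?big_nil.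
Qed.

Lemma big_range2 (F : nat -> V) : \sum_(b <- range 2) F b = \sum_(b : bool) F b.
Proof. by rewrite big_bool -[range 2]/[:: 1; 0]%N !big_cons big_nil addr0. Qed.

Lemma big_words n a (J : finType) (v : J -> nat) (F : seq nat -> V) :
  injective v -> (forall j, v j < a)%N -> (forall i, i < a -> exists j, v j = i)%N ->
  \sum_(w <- words n (range a)) F w = \sum_(f : {ffun 'I_n -> J}) F (word v f).
Proof.
move=> v_inj lt_v v_onto; rewrite -[RHS](big_map (fun f : {ffun 'I_n -> J} => word v f) xpredT F).
apply: perm_big; apply: uniq_perm.
- by apply: words_uniq; rewrite rev_uniq iota_uniq.
- rewrite map_inj_uniq ?index_enum_uniq // => f f' E; apply/ffunP => i.
  by apply: v_inj; rewrite -(nth_word v f) E nth_word.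
move=> w; rewrite mem_words; apply/andP/mapP => [[/eqP size_w /allP lt_w]|[f _ ->]].
  have /fin_all_exists [f fE] (i : 'I_n) : exists j, v j = nth 0%N w i.
    apply: v_onto; have /lt_w : nth 0%N w i \in w by rewrite mem_nth ?size_w.
    by rewrite /= mem_rev mem_iota.
  exists [ffun i => f i]; first exact: mem_index_enum.
  apply: (@eq_from_nth _ 0%N) => [|i]; first by rewrite size_word.
  by rewrite size_w => lt_i; rewrite (nth_word v _ (Ordinal lt_i)) ffunE fE.
rewrite size_word; split=> //.
by apply/allP => _ /mapP [i _ ->]; rewrite /= mem_rev mem_iota /= add0n lt_v.
Qed.

Lemma big_words_bits n (F : seq nat -> V) :
  \sum_(w <- words n (range 2)) F w = \sum_(x : cube n) F (bits x).
Proof.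
apply: big_words => [[] []|[]|[|[|]]] //; by [exists false | exists true].
Qed.

Lemma big_words_labels n a (F : seq nat -> V) :
  \sum_(w <- words n (range a)) F w = \sum_(f : {ffun 'I_n -> 'I_a}) F (labels f).
Proof.
by apply: big_words => [|j|i lt_i]; [exact: val_inj | exact: ltn_ord | exists (Ordinal lt_i)].
Qed.

Lemma uniq_labels n a (f : {ffun 'I_n -> 'I_a}) : uniq (labels f) = injectiveb f.
Proof. by rewrite /word map_comp map_inj_uniq //; exact: val_inj. Qed.

Lemma big_coins (F : coins -> V) :
  \sum_r F r = \sum_b \sum_z \sum_w \sum_w' \sum_x \sum_y F (b, z, w, w', x, y).
Proof.
by rewrite !pair_bigA; apply: eq_bigr => -[[[[[b z] w] w'] x] y].
Qed.

Lemma big_templates (p p' : {ffun 'I_k -> 'I_s}) (F : raw_eqn -> V) :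
  \sum_(t <- templates k s q (labels p) (labels p')) F t
  = \sum_(r : coins) \sum_(c : copies | injectiveb c) F (raw_template p p' r c).
Proof.
rewrite big_coins big_bigcat big_range2; apply: eq_bigr => b _.
rewrite big_bigcat big_words_bits; apply: eq_bigr => z _.
rewrite big_bigcat big_words_labels; apply: eq_bigr => w _.
rewrite big_bigcat big_words_labels; apply: eq_bigr => w' _.
rewrite big_bigcat big_words_bits; apply: eq_bigr => x _.
rewrite big_bigcat big_words_bits; apply: eq_bigr => y _.
rewrite big_bigcat big_mkcond big_words_labels [RHS]big_mkcond; apply: eq_bigr => c _.
by rewrite uniq_labels big_seq1.
Qed.

End Sums.

Lemma shifted_bitE (p : {ffun 'I_k -> 'I_s}) (z : cube s) (w : noise) (b : bool) (x : cube k) i :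
  (i < k)%N ->
  shifted_bit (labels p) (bits z) (labels w) (bits x) b i
    = nth 0 (bits (x + shift p z w b)%R) i.
Proof.
by move=> lt_i; rewrite /shifted_bit !(nth_word _ _ (Ordinal lt_i)) nth_word !ffunE !oddD !oddb.
Qed.

End Test.

Definition untype n (t : lin_eqn n) : raw_eqn := (map val t.1, val t.2).

Lemma enc_raw_untype n (t : lin_eqn n) : enc_raw (untype t) = enc_eqn t.
Proof. by rewrite /enc_raw /enc_eqn /= -enc_seq_map. Qed.

Lemma perm_map_lift (T1 T2 : eqType) (f : T1 -> T2) s1 s2 :
  perm_eq s1 (map f s2) -> exists2 s2', perm_eq s2' s2 & map f s2' = s1.
Proof.
elim: s1 s2 => [|y s1 IHs1] s2 eq12.
  exists [::] => //; rewrite perm_sym; apply/perm_nilP/eqP.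
  by rewrite -size_eq0 -(size_map f) -(perm_size eq12).
have /mapP [x s2x y_x] : y \in map f s2 by rewrite -(perm_mem eq12) mem_head.
have eq2 := perm_to_rem s2x.
have := perm_trans eq12 (perm_map f eq2); rewrite /= -y_x perm_cons => /IHs1 [s2' eq2' <-].
by exists (x :: s2'); rewrite /= ?y_x // (permPr eq2) perm_cons.
Qed.

Section Equations.

Variables (q k s : nat) (L : label_cover k s).

Local Notation E := (lcE L).
Local Notation edge := (lc_edge (lcU L) (lcV L) k s).
Local Notation copies := {ffun 'I_4 -> 'I_s}.
Local Notation nvar := (2 ^ k * s * lcV L).

Definition test_eqn (e e' : edge) (r : coins k s q) (c : copies) : lin_eqn nvar :=
  let P := test_points e.1.2 e'.1.2 e.2 e'.2 r in
  ([tuple var (tnth P j).1 (tnth P j).2 (c j) | j < 4], (test_sign r)%:R%R).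

Definition pair_test_eqns (e e' : edge) : seq (lin_eqn nvar) :=
  [seq test_eqn e e' t.1 t.2 | t in [pred t : coins k s q * copies | injectiveb t.2]].

Definition test_eqns : seq (lin_eqn nvar) :=
  \big[cat/[::]]_(e <- E) \big[cat/[::]]_(e' <- E | e'.1.1 == e.1.1) pair_test_eqns e e'.

Lemma untype_test_eqn e e' r c :
  untype (test_eqn e e' r c)
  = globalize (lcV L) e.1.2 e'.1.2 (raw_template e.2 e'.2 r c).
Proof.
case: r => -[[[[b z] w] w'] x] y; rewrite /untype /globalize /=.
congr (_, _); last by case: b.
rewrite !enum_ordSl enum_ord0 /= /var_index -!(nth_word (@nat_of_ord s) c).
rewrite (eq_point _ (shifted_bitE e.2 z w b x)).
by rewrite (eq_point _ (shifted_bitE e'.2 z w' false y)).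
Qed.

Lemma perm_eq_sum (T : eqType) (s1 s2 : seq T) :
  (forall F : T -> nat, \sum_(x <- s1) F x = \sum_(x <- s2) F x) -> perm_eq s1 s2.
Proof.
by move=> eq_sum; apply/permP => a; rewrite -!sum1_count !(big_mkcond a).
Qed.

Lemma perm_pair_eqns e e' :
  perm_eq (pair_eqns q e e') [seq untype t | t <- pair_test_eqns e e'].
Proof.
apply: perm_eq_sum => F; rewrite big_map big_rev big_templates pair_big_dep.
rewrite !big_map -big_enum; apply: eq_bigr => t _.
by rewrite untype_test_eqn.
Qed.

Lemma perm_raw_eqns : perm_eq (raw_eqns q L) [seq untype t | t <- test_eqns].
Proof.
rewrite perm_rev; apply: perm_eq_sum => F; rewrite big_map !big_bigcat; apply: eq_bigr => e _.
rewrite !big_bigcat; apply: eq_bigr => e' _.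
by rewrite (perm_big _ (perm_pair_eqns e e')) big_map.
Qed.

Lemma uniq_test_eqn e e' r (c : copies) : injectiveb c -> uniq (test_eqn e e' r c).1.
Proof.
move/injectiveP => inj_c; rewrite map_inj_uniq ?enum_uniq // => i j.
by case/var_inj => _ _ /inj_c.
Qed.

Lemma uniq_test_eqns : all (fun t : lin_eqn nvar => uniq t.1) test_eqns.
Proof.
rewrite /test_eqns; elim/big_ind: _ => // [s1 s2 | e _]; first by rewrite all_cat => -> ->.
elim/big_ind: _ => // [s1 s2 | e' _]; first by rewrite all_cat => -> ->.
by apply/allP => _ /imageP [t inj_c ->]; apply: uniq_test_eqn.
Qed.

Lemma outputs_reduction : exists (l : seq (lin_eqn nvar))
    (uniq_l : all (fun t : lin_eqn nvar => uniq t.1) l),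
  perm_eq l test_eqns /\ outputs (reduction q) L (Lin4 uniq_l).
Proof.
have [l perm_l El] := perm_map_lift perm_raw_eqns.
have uniq_l : all (fun t : lin_eqn nvar => uniq t.1) l.
  by rewrite (perm_all _ perm_l) uniq_test_eqns.
exists l, uniq_l; split=> //; rewrite /outputs eval_reduction -El /enc_lin4.
by rewrite -enc_seq_map; congr Node; apply/eq_enc_seq/enc_raw_untype.
Qed.

End Equations.

(** * Running time *)

Lemma tall_enc_seq (T : eqType) (enc : T -> tree) (P : tree -> Prop) s :
  {in s, forall x, P (enc x)} -> tall P (enc_seq enc s).
Proof.
elim: s => //= x s IHs Ps; split; first by apply: Ps; rewrite mem_head.
by apply: IHs => y ys; apply: Ps; rewrite inE ys orbT.
Qed.

Lemma tsize_enc_nat n : tsize (enc_nat n) = (n.*2).+1.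
Proof. by elim: n => // n; rewrite /enc_nat iterS /= => ->; lia. Qed.

Lemma tsize_push (T : Type) (enc : T -> tree) s t :
  tsize (push enc s t) = tsize t + \sum_(x <- s) (tsize (enc x)).+1.
Proof.
rewrite /push; elim: s t => [|x s IHs] t /=; first by rewrite big_nil addn0.
by rewrite IHs big_cons /=; lia.
Qed.

Lemma tsize_enc_seq (T : Type) (enc : T -> tree) s :
  tsize (enc_seq enc s) = (\sum_(x <- s) (tsize (enc x)).+1).+1.
Proof. by elim: s => [|x s IHs]; rewrite ?big_nil ?big_cons //= IHs; lia. Qed.

Lemma tsize_value_add env a b :
  tsize (value env (Eadd a b)) <= tsize (value env b) + 2 * tsize (value env a).
Proof.
rewrite /=; elim: (value env a) (value env b) => [|h _ t IHt] u /=; first exact: leq_addr.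
by apply: leq_trans (IHt _) _ => /=; lia.
Qed.

Lemma tsize_value_tail env l : tsize (value env (Etail l)) <= tsize (value env l).
Proof. by rewrite /=; case: (value env l) => //= h t; lia. Qed.

Lemma tsize_value_proj j env l : tsize (value env (Eproj j l)) <= tsize (value env l).
Proof.
have le_drop : tsize (value env (Edrop j l)) <= tsize (value env l).
  by elim: j => // j IHj; apply: leq_trans (tsize_value_tail _ _) IHj.
by apply: leq_trans le_drop; rewrite /=; case: (value env (Edrop j l)) => //= h t; lia.
Qed.

Lemma polytime_lit D n : polytime D (Elit n).
Proof. by elim: n => [|n IHn]; [|apply: polytime_node => //]; exact: polytime_leaf. Qed.

Lemma polytime_head D l : polytime D l -> polytime D (Ehead l).
Proof.
move=> poly_l; apply: (@polytime_case D (fun=> True)) => //; first exact: polytime_leaf.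
exact: polytime_var.
Qed.

Lemma polytime_tail D l : polytime D l -> polytime D (Etail l).
Proof.
move=> poly_l; apply: (@polytime_case D (fun=> True)) => //; first exact: polytime_leaf.
exact: polytime_var.
Qed.

Lemma polytime_drop D j l : polytime D l -> polytime D (Edrop j l).
Proof. by move=> poly_l; elim: j => //= j; exact: polytime_tail. Qed.

Lemma polytime_proj D j l : polytime D l -> polytime D (Eproj j l).
Proof. by move=> poly_l; apply/polytime_head/polytime_drop. Qed.

Lemma polytime_fold_total D G l a f :
  (forall env h acc, tsize (value [:: h, acc & env] f) <= tsize acc + G (h :: env)) ->
  poly_bounded (fun=> True) G -> polytime (fun=> True) f ->
  polytime D l -> polytime D a -> polytime D (EFold l a f).
Proof.
move=> growth poly_G poly_f poly_l poly_a.
apply: (polytime_fold (D' := fun=> True)) poly_G poly_l poly_a poly_f => [env _|env h acc _].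
  exact: tallT.
exact: growth.
Qed.

Lemma polytime_add D a b : polytime D a -> polytime D b -> polytime D (Eadd a b).
Proof.
apply: (polytime_fold_total (G := fun=> 2)) => [env h acc||]; first by rewrite /=; lia.
  exact: poly_bounded_const.
by apply: polytime_node; [exact: polytime_leaf | exact: polytime_var].
Qed.

Lemma polytime_iter_tail D l a : polytime D l -> polytime D a ->
  polytime D (EFold l a (Etail (EVar 1))).
Proof.
apply: (polytime_fold_total (G := fun=> 0)) => [env h acc||].
- by rewrite addn0; exact: (tsize_value_tail [:: h, acc & env] (EVar 1)).
- exact: poly_bounded_const.
by apply: polytime_tail; exact: polytime_var.
Qed.

Lemma polytime_nth D i l : polytime D i -> polytime D l -> polytime D (Enth i l).
Proof. by move=> poly_i poly_l; apply/polytime_head/polytime_iter_tail. Qed.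

Lemma polytime_dist D a b : polytime D a -> polytime D b -> polytime D (Edist a b).
Proof. by move=> poly_a poly_b; apply: polytime_add; apply: polytime_iter_tail. Qed.

Create HintDb polytime.
#[local] Hint Constants Opaque : polytime.
#[local] Hint Resolve polytime_var polytime_leaf polytime_node polytime_lit polytime_head
  polytime_tail polytime_drop polytime_proj polytime_add polytime_nth polytime_dist : polytime.

Lemma polytime_muladd D i n v : polytime D i -> polytime D n -> polytime D v ->
  polytime D (Emuladd i n v).
Proof.
move=> poly_i poly_n poly_v; apply: (@polytime_let D (fun=> True)); auto with polytime.
apply: (polytime_fold_total (G := fun env => 2 * tsize (nth Leaf env 1))).
- move=> env h acc; apply: leq_trans (tsize_value_add _ _ _) _.
  by rewrite leq_add2l leq_mul2l (tsize_value_proj 1).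
- by bound_poly.
all: by auto with polytime.
Qed.

Lemma polytime_collect D l a f :
  (forall env h acc, value [:: h, acc & env] f = value [:: h, Leaf & env] f) ->
  polytime (fun=> True) f -> polytime D l -> polytime D a ->
  polytime D (EFold l a (ENode f (EVar 1))).
Proof.
move=> f_indep poly_f.
pose reset env := [:: nth Leaf env 0, Leaf & behead env].
apply: (polytime_fold_total (G := fun env => (tsize (value (reset env) f)).+2)).
- by move=> env h acc; rewrite /= f_indep -[[:: h, Leaf & env]]/(reset (h :: env)); lia.
- have : poly_bounded (fun=> True) (fun env => tsize (value (reset env) f)).
    apply: (poly_bounded_comp (F := reset) (g := fun env => tsize (value env f))
      (D' := fun=> True)) => //.
      apply: (poly_bounded_le (g' := fun env => tsize (nth Leaf env 0) + (1 + env_size env))).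
        move=> env _; rewrite /reset !env_size_cons !leq_add2l.
        by case: env => // t env; rewrite env_size_cons leq_addl.
      by bound_poly.
    exact: poly_bounded_value.
  by move=> poly_reset; bound_poly.
by apply: polytime_node => //; exact: polytime_var.
Qed.

Lemma polytime_globalize : polytime (fun=> True) Eglobalize.
Proof.
have poly_v j e : polytime (fun=> True) (Emuladd (Enth (Elit j) (Ehead (EVar 0)))
    (Eproj 1 (EVar 7)) (Eproj 1 (EVar e))).
  by apply: polytime_muladd; auto with polytime.
by do 5! (apply: polytime_node; auto with polytime).
Qed.

Lemma tsize_enc_eqn n (q : lin_eqn n) : tsize (enc_eqn q) <= 8 * n + 5.
Proof.
rewrite /enc_eqn /= tsize_enc_nat tsize_enc_seq.
have sum_le : \sum_(i <- q.1) (tsize (enc_nat i)).+1 <= \sum_(i <- q.1) 2 * n.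
  by apply: leq_sum => i _; rewrite tsize_enc_nat; have := ltn_ord i; lia.
have lt_b : q.2 < 2 := ltn_ord q.2.
move: sum_le; rewrite big_const_seq count_predT size_tuple iter_addn_0 /=; lia.
Qed.

Section RunningTime.

Variables q k s : nat.

Definition tests_bound : nat := #|{: coins k s q * {ffun 'I_4 -> 'I_s}}| * (8 * (2 ^ k * s) + 6).

Lemma lcV_le_tsize (L : label_cover k s) : lcV L <= tsize (enc_lc L).
Proof. by rewrite /enc_lc /= !tsize_enc_nat; lia. Qed.

Lemma size_lcE_le_tsize (L : label_cover k s) : size (lcE L) <= tsize (enc_lc L).
Proof.
rewrite /enc_lc /= tsize_enc_seq -sum1_size.
have : \sum_(e <- lcE L) 1 <= \sum_(e <- lcE L) (tsize (enc_edge e)).+1 by apply: leq_sum.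
lia.
Qed.

Lemma tsize_pair_eqns (L : label_cover k s) (e e' : lc_edge (lcU L) (lcV L) k s) :
  \sum_(r <- pair_eqns q e e') (tsize (enc_raw r)).+1 <= tests_bound * tsize (enc_lc L).
Proof.
rewrite (perm_big _ (perm_pair_eqns _ e e')) big_map.
apply: (@leq_trans (\sum_(t <- pair_test_eqns q e e') (8 * (2 ^ k * s * lcV L) + 6))).
  by apply: leq_sum => t _; rewrite enc_raw_untype; have := tsize_enc_eqn t; lia.
rewrite big_const_seq count_predT iter_addn_0 [leqLHS]mulnC -[leqRHS]mulnA.
apply: leq_mul; first by rewrite size_map -cardE max_card.
have := lcV_le_tsize L; have := tsize_gt0 (enc_lc L).
set n := tsize _; nia.
Qed.

Definition input_env (env : seq tree) : Prop :=
  exists L : label_cover k s, env = [:: enc_nat q; enc_lc L].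

Definition pair_env (env : seq tree) : Prop :=
  exists (L : label_cover k s) (e e' : lc_edge (lcU L) (lcV L) k s) t t' env',
    env = [:: enc_edge e', t', enc_edge e, t, enc_nat q, enc_lc L & env'].

Lemma polytime_templates D :
  (forall env, D env -> exists (p p' : {ffun 'I_k -> 'I_s}) env',
     env = enc_args (labels p) (labels p') k s q :: env') ->
  polytime D Etemplates.
Proof.
move=> DE; pose arg (pp : {ffun 'I_k -> 'I_s} * {ffun 'I_k -> 'I_s}) :=
  [:: enc_args (labels pp.1) (labels pp.2) k s q].
apply: (@polytime_closed _ _ arg) => // _ /DE [p [p' [env' ->]]].
by exists (p, p'), env'.
Qed.

Lemma polytime_pair_eqns : polytime pair_env Epair_eqns.
Proof.
apply: (@polytime_case _ (fun=> True)); auto with polytime.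
apply: polytime_collect; auto with polytime; first exact: polytime_globalize.
pose templates_env env := exists (p p' : {ffun 'I_k -> 'I_s}) env',
  env = enc_args (labels p) (labels p') k s q :: env'.
apply: (@polytime_let _ templates_env); auto 10 with polytime; last exact: polytime_templates.
move=> _ [L [e [e' [t [t' [env' ->]]]]]]; exists e.2, e'.2; eexists.
by rewrite /= /enc_args /word -!enc_seq_map.
Qed.

Lemma tsize_edge_eqns (L : label_cover k s) (e : lc_edge (lcU L) (lcV L) k s) :
  \sum_(r <- edge_eqns q e) (tsize (enc_raw r)).+1 <= tests_bound * tsize (enc_lc L) ^ 2.
Proof.
rewrite big_bigcat big_mkcond.
apply: (@leq_trans (\sum_(e' <- lcE L) tests_bound * tsize (enc_lc L))).
  by apply: leq_sum => e' _; case: ifP => // _; exact: tsize_pair_eqns.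
by rewrite big_const_seq count_predT iter_addn_0 -mulnA leq_mul2l leq_mul2l size_lcE_le_tsize !orbT.
Qed.

Definition edge_env (env : seq tree) : Prop :=
  exists (L : label_cover k s) (e : lc_edge (lcU L) (lcV L) k s) t,
    env = [:: enc_edge e; t; enc_nat q; enc_lc L].

Lemma polytime_edge_eqns : polytime edge_env Eedge_eqns.
Proof.
apply: (polytime_fold (D' := pair_env) (G := fun env => tests_bound * tsize (nth Leaf env 4)));
  auto with polytime.
- move=> _ [L [e [t ->]]]; apply: (@tall_enc_seq _ (@enc_edge _ _ k s)) => e' _ t'.
  by exists L, e, e', t, t', [::].
- move=> env h t [L [e [e' [t' [t1 [env' [-> -> ->]]]]]]].
  rewrite value_pair_eqns tsize_push leq_add2l; case: ifP => _; last by rewrite big_nil.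
  exact: tsize_pair_eqns.
- by bound_poly.
exact: polytime_pair_eqns.
Qed.

Lemma polytime_nvar : polytime input_env Envar.
Proof.
apply: polytime_muladd; auto with polytime.
pose width_env env := exists env', env = Node (enc_nat k) (enc_nat s) :: env'.
apply: (@polytime_let _ width_env); auto with polytime.
  by move=> _ [L ->]; eexists.
apply: (@polytime_closed _ unit (fun=> [:: Node (enc_nat k) (enc_nat s)])) => [//|_ [env' ->]].
by exists tt, env'.
Qed.

Lemma polytime_reduction :
  polytime (fun env => exists L : label_cover k s, env = [:: enc_lc L]) (reduction q).
Proof.
apply: (@polytime_let _ input_env); auto with polytime.
  by move=> _ [L ->]; exists L; rewrite value_lit.
apply: polytime_node; first exact: polytime_nvar.
apply: (polytime_fold (D' := edge_env)
  (G := fun env => tests_bound * tsize (nth Leaf env 2) ^ 2)); auto with polytime.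
- move=> _ [L ->]; apply: (@tall_enc_seq _ (@enc_edge _ _ k s)) => e _ t.
  by exists L, e, t.
- move=> env h t [L [e [t' [-> -> ->]]]].
  by rewrite value_edge_eqns tsize_push leq_add2l; exact: tsize_edge_eqns.
- by bound_poly.
exact: polytime_edge_eqns.
Qed.

End RunningTime.

Lemma efficient_reduction q : efficient (reduction q).
Proof.
move=> k s; have [d le_d] := polytime_reduction q k s.
exists (3 ^ d), d => L; rewrite /cost execE [leqLHS]/=.
apply: leq_trans (le_d [:: enc_lc L] _) _; first by exists L.
rewrite -expnMn; apply: leq_wexp2r; rewrite env_size_cons.
have -> : env_size [::] = 2 by rewrite /env_size big_nil.
by have := tsize_gt0 (enc_lc L); lia.
Qed.

(** * Means over finite types *)

Local Open Scope ring_scope.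

Definition mean (R : realFieldType) (T : finType) (F : T -> R) : R := (\sum_x F x) / #|T|%:R.

Local Notation "\mean_ ( x : T ) F" := (mean (fun x : T => F))
  (at level 41, F at level 41, x, T at level 50).
Local Notation "\mean_ x F" := (mean (fun x => F)) (at level 41, F at level 41, x at level 0).

Section Mean.

Variable R : realFieldType.
Implicit Types T I : finType.

Lemma eq_mean T (F G : T -> R) : F =1 G -> mean F = mean G.
Proof. by move=> FG; congr (_ / _); apply: eq_bigr. Qed.

Lemma mulr_mean T (F : T -> R) : #|T|%:R * mean F = \sum_x F x.
Proof.
rewrite /mean mulrCA; have [T0|T0] := posnP #|T|; last by rewrite divff ?mulr1 ?pnatr_eq0 -?lt0n.
by rewrite big_pred0 ?mul0r // => x; have := fintype0 x T0.
Qed.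

Lemma mean_const T (c : R) : (0 < #|T|)%N -> \mean_(x : T) c = c.
Proof. by move=> T0; rewrite /mean sumr_const -[_ *+ _]mulr_natr mulfK // pnatr_eq0 -lt0n. Qed.

Lemma meanZ T c (F : T -> R) : \mean_x (c * F x) = c * mean F.
Proof. by rewrite /mean -mulr_sumr mulrA. Qed.

Lemma meanZr T c (F : T -> R) : \mean_x (F x * c) = mean F * c.
Proof. by rewrite mulrC -meanZ; apply: eq_mean => x; rewrite mulrC. Qed.

Lemma meanD T (F G : T -> R) : \mean_x (F x + G x) = mean F + mean G.
Proof. by rewrite /mean big_split mulrDl. Qed.

Lemma mean_sum T I (F : I -> T -> R) : \mean_x \sum_i F i x = \sum_i mean (F i).
Proof. by rewrite /mean exchange_big /= mulr_suml. Qed.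

Lemma ler_mean T (F G : T -> R) : (forall x, F x <= G x) -> mean F <= mean G.
Proof. by move=> FG; rewrite ler_wpM2r ?invr_ge0 ?ler0n // ler_sum. Qed.

Lemma mean_norm_le1 T (F : T -> R) : (forall x, `|F x| <= 1) -> `|mean F| <= 1.
Proof.
move=> F1; rewrite normrM normfV (ger0_norm (ler0n _ _)).
apply: le_trans (ler_wpM2r _ (ler_norm_sum _ _ _)) _; first by rewrite invr_ge0.
apply: (@le_trans _ _ (\mean_(x : T) 1)); first exact: ler_mean.
by have [T0|T0] := posnP #|T|; [rewrite /mean T0 invr0 mulr0 | rewrite mean_const].
Qed.

Lemma mean_pair T I (F : T * I -> R) : mean F = \mean_x \mean_y F (x, y).
Proof.
rewrite /mean card_prod natrM invfM mulrA mulrAC -mulr_suml pair_bigA /=.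
by congr (_ / _ / _); apply: eq_bigr => -[].
Qed.

Lemma mean_mul T I (F : T -> R) (G : I -> R) :
  mean F * mean G = \mean_x \mean_y (F x * G y).
Proof. by rewrite -meanZr; apply: eq_mean => x; rewrite meanZ. Qed.

Lemma mean_prod_ffun I T (F : I -> T -> R) :
  \mean_(f : {ffun I -> T}) \prod_i F i (f i) = \prod_i mean (F i).
Proof.
by rewrite /mean big_split /= prodr_const -bigA_distr_bigA /= card_ffun natrX exprVn.
Qed.

Lemma mean_delta T (F : T -> R) z : \mean_x (F x * (#|T|%:R * (x == z)%:R)) = F z.
Proof.
have T0 : #|T|%:R != 0 :> R by rewrite pnatr_eq0 -lt0n; apply/card_gt0P; exists z.
rewrite /mean (bigD1 z) //= big1 => [|x /negbTE ->]; last by rewrite !mulr0.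
by rewrite eqxx mulr1 addr0 mulfK.
Qed.

Lemma mean_bool (F : bool -> R) : mean F = (F true + F false) / 2.
Proof. by rewrite /mean big_bool card_bool. Qed.

End Mean.

(** * Fourier analysis of the test *)

Section Characters.

Variable R : realFieldType.

Definition chi n (a x : cube n) : R := \prod_i (-1) ^+ (a i && x i).

Lemma signr_sum (I : finType) (P : pred I) (F : I -> bool) :
  (-1) ^+ (\sum_(i | P i) F i)%R = \prod_(i | P i) (-1) ^+ F i :> R.
Proof. by apply: (big_morph (fun b : bool => (-1) ^+ b : R)) => // b c; exact: signr_addb. Qed.

Section Cube.

Variable n : nat.
Implicit Types (a x y : cube n) (F : cube n -> R).

Lemma oppc x : - x = x.
Proof. by apply/ffunP => i; rewrite ffunE. Qed.

Lemma card_cube_gt0 : (0 < #|{: cube n}|)%N.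
Proof. by rewrite card_ffun card_bool expn_gt0. Qed.

Lemma chiC a x : chi a x = chi x a.
Proof. by apply: eq_bigr => i _; rewrite andbC. Qed.

Lemma chiD a x y : chi a (x + y) = chi a x * chi a y.
Proof.
rewrite -big_split; apply: eq_bigr => i _ /=.
by rewrite ffunE; case: (a i) => /=; rewrite ?signr_addb // mulr1.
Qed.

Lemma chi0r a : chi a 0 = 1.
Proof. by apply: big1 => i _; rewrite ffunE andbF. Qed.

Lemma mean_chi a : \mean_x chi a x = (a == 0)%:R.
Proof.
rewrite (mean_prod_ffun (fun i (b : bool) => (-1) ^+ (a i && b) : R)).
under eq_bigr do rewrite mean_bool andbT andbF expr0.
have [->|/eqP a0] := eqVneq a 0; first by apply: big1 => i _; rewrite ffunE expr0; field.
have [i ai] : exists i, a i.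
  apply/existsP; apply: contra_notT a0 => /existsPn a0; apply/ffunP => i.
  by rewrite ffunE; apply/negbTE.
by rewrite (bigD1 i) //= ai expr1 addNr !mul0r.
Qed.

Definition hat F a : R := \mean_x (F x * chi a x).
Definition energy F a : R := hat F a ^+ 2.

Lemma energy_ge0 F a : 0 <= energy F a.
Proof. exact: sqr_ge0. Qed.

Lemma energy0 F : energy F 0 = mean F ^+ 2.
Proof. by congr (_ ^+ 2); apply: eq_mean => x; rewrite chiC chi0r mulr1. Qed.

Lemma autocorrelation F t : \mean_x (F x * F (x + t)) = \sum_a energy F a * chi a t.
Proof.
have energy_chi a : energy F a * chi a t = \mean_x \mean_y (F x * F y * chi a (x + y + t)).
  rewrite /energy expr2 mean_mul -meanZr; apply: eq_mean => x.
  by rewrite -meanZr; apply: eq_mean => y; rewrite !chiD; ring.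
under [RHS]eq_bigr do rewrite energy_chi.
rewrite -mean_sum; apply: eq_mean => x; rewrite -mean_sum -[LHS](mean_delta (fun y => F x * F y)).
apply: eq_mean => y; rewrite -mulr_sumr; congr (_ * _).
under [RHS]eq_bigr do rewrite chiC.
by rewrite -mulr_mean mean_chi addrAC addrC addr_eq0 oppc.
Qed.

Lemma parseval F : \sum_a energy F a = \mean_x F x ^+ 2.
Proof.
have := autocorrelation F 0; under eq_bigr do rewrite chi0r mulr1.
by move=> <-; apply: eq_mean => x; rewrite addr0 expr2.
Qed.

Definition parity a : bool := \sum_i a i.

Lemma chi_const a b : chi a [ffun=> b] = (-1) ^+ (parity a && b).
Proof.
case: b; first by rewrite andbT signr_sum; apply: eq_bigr => i _; rewrite ffunE andbT.
by rewrite andbF; apply: big1 => i _; rewrite ffunE andbF.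
Qed.

Lemma mean_sign_chi (eps : bool) a :
  \mean_(b : bool) ((-1) ^+ (eps && b) * chi a [ffun=> b]) = (parity a == eps)%:R.
Proof.
by rewrite mean_bool !chi_const !andbT !andbF; case: eps; case: (parity a); rewrite /=; field.
Qed.

End Cube.

Section Pushforward.

Variables (k s : nat) (p p' : {ffun 'I_k -> 'I_s}).
Implicit Types (a : cube k) (z : cube s).

Definition comp_cube (r : {ffun 'I_k -> 'I_s}) z : cube k := [ffun i => z (r i)].

Definition pushforward (r : {ffun 'I_k -> 'I_s}) a : cube s := [ffun j => \sum_(i | r i == j) a i].

Lemma chi_comp r a z : chi a (comp_cube r z) = chi (pushforward r a) z.
Proof.
rewrite /chi (partition_big r xpredT) //=; apply: eq_bigr => j _.
rewrite ffunE; case zj: (z j); last first.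
  by rewrite andbF; apply: big1 => i /eqP rij; rewrite ffunE rij zj andbF.
by rewrite andbT signr_sum; apply: eq_bigr => i /eqP rij; rewrite ffunE rij zj andbT.
Qed.

Lemma mean_chi_comp a a' :
  \mean_z (chi a (comp_cube p z) * chi a' (comp_cube p' z))
  = (pushforward p a == pushforward p' a')%:R.
Proof.
rewrite -[_ == _]subr_eq0 -mean_chi; apply: eq_mean => z.
by rewrite !chi_comp ![chi _ z]chiC oppc chiD.
Qed.

Lemma pushforward_exists r a j : pushforward r a j -> exists2 i, a i & r i = j.
Proof.
rewrite ffunE => push_j.
suff /existsP [i /andP [ai /eqP rij]] : [exists i, a i && (r i == j)] by exists i.
apply: contraTT push_j => /existsPn no_i; rewrite big1 // => i rij.
by have := no_i i; rewrite rij andbT => /negbTE.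
Qed.

Lemma pushforward_meet a a' : parity a -> pushforward p a = pushforward p' a' ->
  exists i i', [/\ a i, a' i' & p i = p' i'].
Proof.
move=> odd_a eq_push.
have [j push_j] : exists j, pushforward p a j.
  apply/existsP; apply: contraTT odd_a => /existsPn push0; rewrite /parity.
  rewrite (partition_big p xpredT) //= big1 // => j _.
  by have := push0 j; rewrite ffunE => /negbTE.
have [i ai pij] := pushforward_exists push_j.
have [i' ai' pij'] : exists2 i', a' i' & p' i' = j by apply: pushforward_exists; rewrite -eq_push.
by exists i, i'; rewrite pij pij'.
Qed.

End Pushforward.

Section Noise.

Variables k q : nat.
Implicit Types a : cube k.

Definition noise (w : {ffun 'I_k -> 'I_q}) : cube k := [ffun i => w i == 0%N :> nat].
Definition noise_mean a : R := \mean_w chi a (noise w).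
Definition weight a : nat := \sum_i a i.

Lemma noise_meanE a : (0 < q)%N -> noise_mean a = (1 - 2 / q%:R) ^+ weight a.
Proof.
move=> q0; rewrite /weight -prodrXr.
transitivity (\mean_(w : {ffun 'I_k -> 'I_q}) \prod_i (-1) ^+ (a i && (w i == 0%N :> nat)) : R).
  by apply: eq_mean => w; apply: eq_bigr => i _; rewrite ffunE.
rewrite (mean_prod_ffun (fun i (o : 'I_q) => (-1) ^+ (a i && (o == 0%N :> nat)) : R)).
apply: eq_bigr => i _; case: (a i); last by apply: mean_const; rewrite card_ord.
have q0' : q%:R != 0 :> R by rewrite pnatr_eq0 -lt0n.
rewrite expr1 /mean card_ord (bigD1 (Ordinal q0)) //= (eq_bigr (fun=> 1)) => [|o]; last first.
  by rewrite -val_eqE /= => /negbTE ->.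
by rewrite sumr_const cardC1 card_ord -subn1 natrB //; field.
Qed.

Lemma noise_mean_ge0 a : (1 < q)%N -> 0 <= noise_mean a.
Proof.
move=> q1; rewrite noise_meanE ?(ltnW q1) // exprn_ge0 // subr_ge0.
by rewrite ler_pdivrMr ?ltr0n ?(ltnW q1) // mul1r ler_nat.
Qed.

Lemma exprn_muln_le (r : R) n : 0 <= r < 1 -> r ^+ n * n%:R <= (1 - r)^-1.
Proof.
case/andP=> r0 r1; rewrite -[leRHS]mul1r ler_pdivlMr ?subr_gt0 //.
apply: (@le_trans _ _ ((1 - r) * \sum_(i < n) r ^+ i)).
  have r_le1 := ltW r1; rewrite mulrC ler_wpM2l ?subr_ge0 //.
  rewrite mulr_natr -[n in _ *+ n]card_ord -sumr_const.
  by apply: ler_sum => i _; rewrite ler_wiXn2l // ltnW.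
by rewrite -opprB mulNr -subrX1 opprB gerBl exprn_ge0.
Qed.

Lemma noise_mean_weight a : (1 < q)%N -> noise_mean a * (weight a)%:R <= q%:R / 2.
Proof.
move=> q1; have q0 : 0 < q%:R :> R by rewrite ltr0n ltnW.
have rho_lt1 : 0 <= (1 - 2 / q%:R : R) < 1.
  by rewrite subr_ge0 ler_pdivrMr // mul1r ler_nat q1 ltrBlDr ltrDl divr_gt0.
rewrite noise_meanE ?(ltnW q1) //; apply: le_trans (exprn_muln_le _ rho_lt1) _.
by rewrite subKr invf_div.
Qed.

End Noise.

Section LocalTest.

Variables (k s q : nat) (p p' : {ffun 'I_k -> 'I_s}).
Implicit Types (a : cube k) (F G : cube k -> R).

Definition local_test (eps : bool) F G : R :=
  \mean_(r : coins k s q) ((-1) ^+ (eps && test_sign r)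
    * \prod_(P <- test_points F G p p' r) P.1 P.2).

Lemma shiftE (r : {ffun 'I_k -> 'I_s}) z (w : {ffun 'I_k -> 'I_q}) b :
  shift r z w b = comp_cube r z + ([ffun=> b] + noise w).
Proof. by apply/ffunP => i; rewrite !ffunE. Qed.

Lemma mean_coins (f : coins k s q -> R) :
  mean f = \mean_b \mean_z \mean_w \mean_w' \mean_x \mean_y f (b, z, w, w', x, y).
Proof. by rewrite !mean_pair. Qed.

Lemma mean_test_points (eps b : bool) F G (z : cube s) (w w' : {ffun 'I_k -> 'I_q}) :
  \mean_x \mean_y ((-1) ^+ (eps && b)
    * \prod_(P <- test_points F G p p' (b, z, w, w', x, y)) P.1 P.2)
  = \sum_a \sum_a' energy F a * energy G a'
      * ((-1) ^+ (eps && b) * chi a [ffun=> b]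
         * (chi a (comp_cube p z) * chi a' (comp_cube p' z))
         * (chi a (noise w) * chi a' (noise w'))).
Proof.
transitivity ((-1) ^+ (eps && b) * ((\mean_x (F x * F (x + shift p z w b)))
    * (\mean_y (G y * G (y + shift p' z w' false))))).
  rewrite mean_mul -meanZ; apply: eq_mean => x; rewrite -meanZ; apply: eq_mean => y.
  by rewrite !big_cons big_nil /= mulr1 !mulrA.
rewrite !autocorrelation big_distrlr /= mulr_sumr; apply: eq_bigr => a _.
rewrite mulr_sumr; apply: eq_bigr => a' _.
by rewrite !shiftE !chiD !chi_const andbF expr0; ring.
Qed.

Lemma local_testE eps F G :
  local_test eps F G = \sum_a \sum_a' energy F a * energy G a'
    * ((parity a == eps)%:R * (pushforward p a == pushforward p' a')%:R
       * (noise_mean q a * noise_mean q a')).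
Proof.
rewrite /local_test mean_coins.
under eq_mean => b do under eq_mean => z do under eq_mean => w do
  under eq_mean => w' do rewrite mean_test_points.
have swap (T : finType) (f : cube k -> cube k -> T -> R) :
    \mean_t \sum_a \sum_a' f a a' t = \sum_a \sum_a' \mean_t f a a' t.
  by rewrite mean_sum; apply: eq_bigr => a _; rewrite mean_sum.
under eq_mean => b do under eq_mean => z do under eq_mean => w do rewrite swap.
under eq_mean => b do under eq_mean => z do rewrite swap.
under eq_mean => b do rewrite swap.
rewrite swap; apply: eq_bigr => a _; apply: eq_bigr => a' _.
rewrite -mean_sign_chi -mean_chi_comp mean_mul [X in _ = _ * (_ * X)]mean_mul.
rewrite -meanZr -meanZ; apply: eq_mean => b.
rewrite -meanZr -meanZ; apply: eq_mean => z; rewrite -!meanZ; apply: eq_mean => w.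
by rewrite -!meanZ.
Qed.

Definition decode F i : R := \sum_a energy F a * ((a i)%:R / (weight a)%:R).

(* The probability that uniform elements of [a] and [a'] are projected to the same label. *)
Definition agreement a a' : R :=
  \sum_i \sum_i' (a i)%:R / (weight a)%:R * ((a' i')%:R / (weight a')%:R) * (p i == p' i')%:R.

Lemma weight_gt0 a i : a i -> 0 < (weight a)%:R :> R.
Proof. by move=> ai; rewrite ltr0n /weight (bigD1 i) //= ai. Qed.

Lemma agreement_term_ge0 a a' i i' :
  0 <= (a i)%:R / (weight a)%:R * ((a' i')%:R / (weight a')%:R) * (p i == p' i')%:R :> R.
Proof. by rewrite !mulr_ge0 ?invr_ge0. Qed.

Lemma agreement_ge0 a a' : 0 <= agreement a a'.
Proof. by do 2! (apply: sumr_ge0 => ? _); exact: agreement_term_ge0. Qed.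

Lemma agreement_ge a a' i i' : a i -> a' i' -> p i = p' i' ->
  ((weight a)%:R * (weight a')%:R)^-1 <= agreement a a'.
Proof.
move=> ai ai' pii'; rewrite /agreement (bigD1 i) //= (bigD1 i') //= ai ai' pii' eqxx.
rewrite !mul1r mulr1 invfM -addrA lerDl addr_ge0 //.
  by apply: sumr_ge0 => j _; have := agreement_term_ge0 a a' i j; rewrite ai pii' mul1r.
by do 2! (apply: sumr_ge0 => ? _); exact: agreement_term_ge0.
Qed.

Lemma sum_decode_agreement F G :
  \sum_i \sum_i' decode F i * decode G i' * (p i == p' i')%:R
  = \sum_a \sum_a' energy F a * energy G a' * agreement a a'.
Proof.
transitivity (\sum_i \sum_i' \sum_a \sum_a' energy F a * energy G a'
    * ((a i)%:R / (weight a)%:R * ((a' i')%:R / (weight a')%:R) * (p i == p' i')%:R)).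
  apply: eq_bigr => i _; apply: eq_bigr => i' _; rewrite big_distrlr mulr_suml.
  by apply: eq_bigr => a _; rewrite mulr_suml; apply: eq_bigr => a' _ /=; ring.
under eq_bigr => i _ do rewrite exchange_big.
rewrite exchange_big; apply: eq_bigr => a _.
under eq_bigr => i _ do rewrite exchange_big.
rewrite exchange_big; apply: eq_bigr => a' _; rewrite mulr_sumr.
by apply: eq_bigr => i _; rewrite mulr_sumr.
Qed.

Lemma test_coefficient_le a a' : (1 < q)%N ->
  (parity a == true)%:R * (pushforward p a == pushforward p' a')%:R
    * (noise_mean q a * noise_mean q a') <= (q%:R / 2) ^+ 2 * agreement a a'.
Proof.
move=> q1; have [odd_a|_] := boolP (parity a); last first.
  by rewrite !mul0r mulr_ge0 ?agreement_ge0 ?exprn_ge0 ?divr_ge0.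
have [push_eq|_] := eqVneq (pushforward p a); last first.
  by rewrite mulr0 mul0r mulr_ge0 ?agreement_ge0 ?exprn_ge0 ?divr_ge0.
have [i [i' [ai ai' pii']]] := pushforward_meet odd_a push_eq.
have wa := weight_gt0 ai; have wa' := weight_gt0 ai'.
rewrite !mul1r; apply: le_trans (ler_wpM2l _ (agreement_ge ai ai' pii')); last first.
  by rewrite exprn_ge0 ?divr_ge0.
rewrite ler_pdivlMr ?mulr_gt0 // mulrACA expr2.
by apply: ler_pM; rewrite ?noise_mean_weight // mulr_ge0 // noise_mean_ge0.
Qed.

Lemma local_test_true_le F G : (1 < q)%N ->
  local_test true F G <= (q%:R / 2) ^+ 2
    * \sum_i \sum_i' decode F i * decode G i' * (p i == p' i')%:R.
Proof.
move=> q1; rewrite sum_decode_agreement local_testE mulr_sumr; apply: ler_sum => a _.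
rewrite mulr_sumr; apply: ler_sum => a' _; rewrite [leRHS]mulrCA.
by apply: ler_wpM2l; [rewrite mulr_ge0 ?energy_ge0 | exact: test_coefficient_le].
Qed.

Lemma local_test_false_ge F G : (1 < q)%N ->
  mean F ^+ 2 * mean G ^+ 2 <= local_test false F G.
Proof.
move=> q1; have term_ge0 a a' : 0 <= energy F a * energy G a'
    * ((parity a == false)%:R * (pushforward p a == pushforward p' a')%:R
       * (noise_mean q a * noise_mean q a')).
  apply: mulr_ge0; first by rewrite mulr_ge0 ?energy_ge0.
  by rewrite mulr_ge0 // mulr_ge0 ?noise_mean_ge0.
have parity0 : parity (0 : cube k) = false by apply: big1 => i _; rewrite ffunE.
have pushforward0 r : pushforward r (0 : cube k) = 0.
  by apply/ffunP => j; rewrite !ffunE big1 // => i _; rewrite ffunE.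
have noise_mean0 : noise_mean q (0 : cube k) = 1.
  by rewrite noise_meanE ?(ltnW q1) // /weight big1 // => i _; rewrite ffunE.
rewrite local_testE (bigD1 (0 : cube k)) //= (bigD1 (0 : cube k)) //= -addrA -[leLHS]addr0.
apply: lerD; first by rewrite !energy0 parity0 !pushforward0 noise_mean0 !eqxx !mulr1.
by apply: addr_ge0; do ?[apply: sumr_ge0 => ? _]; exact: term_ge0.
Qed.

Lemma decode_ge0 F i : 0 <= decode F i.
Proof. by apply: sumr_ge0 => a _; rewrite mulr_ge0 ?energy_ge0 ?divr_ge0. Qed.

Lemma sum_decode_le F : \sum_i decode F i <= \mean_x F x ^+ 2.
Proof.
rewrite -parseval exchange_big; apply: ler_sum => a _ /=.
rewrite -mulr_sumr -mulr_suml -natr_sum -/(weight a); apply: ler_piMr; first exact: energy_ge0.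
by case: (weight a) => [|n]; rewrite ?mul0r // divff ?pnatr_eq0.
Qed.

End LocalTest.

End Characters.

(** * Fractional labelings and pairs of edges *)

Lemma sqr_sum_le (R : realFieldType) (I : Type) (r : seq I) (P : pred I) (F : I -> R) :
  (\sum_(i <- r | P i) F i) ^+ 2
  <= (\sum_(i <- r | P i) 1) * \sum_(i <- r | P i) F i ^+ 2.
Proof.
set S := \sum_(i <- r | P i) F i; set n := \sum_(i <- r | P i) 1.
set Q := \sum_(i <- r | P i) F i ^+ 2.
have : 0 <= \sum_(i <- r | P i) \sum_(j <- r | P j) (F i - F j) ^+ 2.
  by do 2! (apply: sumr_ge0 => ? _); exact: sqr_ge0.
have -> : \sum_(i <- r | P i) \sum_(j <- r | P j) (F i - F j) ^+ 2
    = \sum_(i <- r | P i) \sum_(j <- r | P j) (1 * F j ^+ 2 + F i ^+ 2 * 1 + (-2 * F i) * F j).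
  by apply: eq_bigr => i _; apply: eq_bigr => j _; ring.
under eq_bigr do rewrite !big_split.
rewrite !big_split -!big_distrlr -mulr_sumr /= -/S -/n -/Q.
have -> : n * Q + Q * n + -2 * S * S = 2 * (n * Q - S ^+ 2) by ring.
by rewrite pmulr_rge0 // subr_ge0.
Qed.

Lemma sum_le_max (R : realFieldType) (I : finType) (p F : I -> R) (i0 : I) :
  (forall i, 0 <= p i) -> \sum_i p i <= 1 -> (forall i, 0 <= F i) ->
  exists i, \sum_j p j * F j <= F i.
Proof.
move=> p_ge0 p_le1 F_ge0.
have [i _ F_le] := Order.TotalTheory.arg_maxP F (isT : xpredT i0); exists i.
apply: (@le_trans _ _ (\sum_j p j * F i)).
  by apply: ler_sum => j _; apply: ler_wpM2l => //; exact: F_le.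
by rewrite -mulr_suml ler_piMl.
Qed.

Section LabelCover.

Variables (R : realType) (k s : nat) (L : label_cover k s).

Local Notation E := (lcE L).
Local Notation edge := (lc_edge (lcU L) (lcV L) k s).
Local Notation n := (size E).

Lemma size_lcE_gt0 : 0 < n%:R :> R.
Proof. by rewrite ltr0n lc_nonempty. Qed.

Lemma Val_ge0 : 0 <= Val R L.
Proof. by rewrite divr_ge0. Qed.

Lemma mulr_Val : Val R L * n%:R = (\max_(l : labeling L) count (lc_sat l) E)%:R.
Proof. by rewrite /Val divfK // lt0r_neq0 // size_lcE_gt0. Qed.

Lemma count_le_Val (l : labeling L) : (count (lc_sat l) E)%:R <= Val R L * n%:R.
Proof. by rewrite mulr_Val ler_nat; exact: (leq_bigmax l). Qed.

Lemma sum_by_lcU (F : edge -> R) : \sum_(e <- E) F e = \sum_u \sum_(e <- E | e.1.1 == u) F e.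
Proof. exact: (partition_big (fun e : edge => e.1.1) xpredT). Qed.

Lemma sum_by_lcV (F : edge -> R) : \sum_(e <- E) F e = \sum_v \sum_(e <- E | e.1.2 == v) F e.
Proof. exact: (partition_big (fun e : edge => e.1.2) xpredT). Qed.

Lemma exists_edge : exists e : edge, e \in E.
Proof. by have := lc_nonempty L; case: (lcE L) => // e es _; exists e; rewrite mem_head. Qed.

Lemma lcU_gt0 : (0 < lcU L)%N.
Proof. by have [e _] := exists_edge; exact: leq_trans (ltn_ord e.1.1). Qed.

Lemma lcV_gt0 : (0 < lcV L)%N.
Proof. by have [e _] := exists_edge; exact: leq_trans (ltn_ord e.1.2). Qed.

Definition label0 : 'I_k := Ordinal (lc_labels L).

Lemma lc_labelsU : (0 < s)%N.
Proof. by have [e _] := exists_edge; exact: leq_trans (ltn_ord (e.2 label0)). Qed.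

(* Rounding by conditional expectations, first on V and then on U. *)
Lemma fractional_labeling (p : 'I_(lcV L) -> 'I_k -> R) (r : 'I_(lcU L) -> 'I_s -> R) :
  (forall v i, 0 <= p v i) -> (forall v, \sum_i p v i <= 1) ->
  (forall u j, 0 <= r u j) -> (forall u, \sum_j r u j <= 1) ->
  \sum_(e <- E) \sum_i p e.1.2 i * r e.1.1 (e.2 i) <= Val R L * n%:R.
Proof.
move=> p_ge0 p_le1 r_ge0 r_le1.
pose gainV v i := \sum_(e <- E | e.1.2 == v) r e.1.1 (e.2 i).
have gainV_ge0 v i : 0 <= gainV v i by apply: sumr_ge0.
have /fin_all_exists [lv lvP] v := sum_le_max label0 (p_ge0 v) (p_le1 v) (gainV_ge0 v).
pose gainU u j : R := \sum_(e <- E | e.1.1 == u) (e.2 (lv e.1.2) == j)%:R.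
have gainU_ge0 u j : 0 <= gainU u j by apply: sumr_ge0.
have /fin_all_exists [lu luP] u :=
  sum_le_max (Ordinal lc_labelsU) (r_ge0 u) (r_le1 u) (gainU_ge0 u).
apply: le_trans (count_le_Val ([ffun u => lu u], [ffun v => lv v])).
apply: (@le_trans _ _ (\sum_(e <- E) r e.1.1 (e.2 (lv e.1.2)))).
  rewrite [leLHS]sum_by_lcV [leRHS]sum_by_lcV; apply: ler_sum => v _.
  have -> : \sum_(e <- E | e.1.2 == v) r e.1.1 (e.2 (lv e.1.2)) = gainV v (lv v).
    by apply: eq_bigr => e /eqP ->.
  apply: le_trans (lvP v); under [leRHS]eq_bigr do rewrite mulr_sumr.
  by rewrite [leRHS]exchange_big; apply: ler_sum => e /eqP ->.
have -> : (count (lc_sat ([ffun u => lu u], [ffun v => lv v])) E)%:R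
    = \sum_(e <- E) (e.2 (lv e.1.2) == lu e.1.1)%:R :> R.
  rewrite -sum1_count natr_sum big_mkcond; apply: eq_bigr => e _.
  by rewrite /lc_sat /= !ffunE; case: eqP.
rewrite [leLHS]sum_by_lcU [leRHS]sum_by_lcU; apply: ler_sum => u _.
have -> : \sum_(e <- E | e.1.1 == u) (e.2 (lv e.1.2) == lu e.1.1)%:R = gainU u (lu u).
  by apply: eq_bigr => e /eqP ->.
apply: le_trans (luP u); under [leRHS]eq_bigr do rewrite mulr_sumr.
rewrite [leRHS]exchange_big; apply: ler_sum => e /eqP -> /=.
rewrite (bigD1 (e.2 (lv e.1.2))) //= eqxx mulr1 lerDl.
by apply: sumr_ge0 => j _; rewrite mulr_ge0.
Qed.

Lemma Val_ge_invs : s%:R^-1 <= Val R L.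
Proof.
have s0 : s%:R != 0 :> R by rewrite pnatr_eq0 -lt0n lc_labelsU.
have sum_delta c : \sum_(i : 'I_k) (i == label0)%:R * c = c :> R.
  by rewrite (bigD1 label0) // eqxx mul1r big1 /= ?addr0 // => i /negbTE ->; rewrite mul0r.
pose p (v : 'I_(lcV L)) i : R := (i == label0)%:R.
pose r (u : 'I_(lcU L)) (j : 'I_s) : R := s%:R^-1.
have p_le1 v : \sum_i p v i <= 1 by rewrite -(sum_delta 1); apply: ler_sum => i _; rewrite mulr1.
have r_le1 u : \sum_j r u j <= 1 by rewrite sumr_const card_ord -[_^-1 *+ _]mulr_natr mulVf.
have := @fractional_labeling p r (fun _ _ => ler0n _ _) p_le1 _ r_le1; rewrite /p /r.
under eq_bigr do rewrite sum_delta.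
rewrite big_const_seq count_predT iter_addr_0 -[_ *+ n]mulr_natr ler_pM2r ?size_lcE_gt0 //.
by apply=> u j; rewrite invr_ge0.
Qed.

Lemma Val1_labeling : Val R L = 1 -> exists l : labeling L, all (lc_sat l) E.
Proof.
move=> V1; have := mulr_Val; rewrite V1 mul1r => /eqP; rewrite eqr_nat => /eqP n_max.
have labelings : (0 < #|{: labeling L}|)%N.
  by apply/card_gt0P; exists ([ffun=> Ordinal lc_labelsU], [ffun=> label0]).
have [l l_max] := bigop.eq_bigmax (fun l : labeling L => count (lc_sat l) E) labelings.
by exists l; rewrite all_count -l_max -n_max.
Qed.

Lemma size_by_vertex (N : nat) (f : edge -> 'I_N) d :
  (forall v, count (fun e => f e == v) E = d) -> n = (N * d)%N.
Proof.
move=> count_d; rewrite -sum1_size (partition_big f xpredT) //=.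
under eq_bigr do rewrite sum1_count count_d.
by rewrite sum_nat_const card_ord.
Qed.

Definition degU : nat := n %/ lcU L.

Lemma count_degU u : count (fun e : edge => e.1.1 == u) E = degU.
Proof.
have [d count_d] := lc_regU L.
by rewrite count_d /degU (size_by_vertex count_d) mulKn ?lcU_gt0.
Qed.

Lemma size_degU : n = (lcU L * degU)%N.
Proof. exact: size_by_vertex count_degU. Qed.

Lemma degU_gt0 : 0 < degU%:R :> R.
Proof. by have := size_lcE_gt0; rewrite size_degU natrM pmulr_rgt0 // ltr0n lcU_gt0. Qed.

Lemma sum_lcV (F : 'I_(lcV L) -> R) : \sum_(e <- E) F e.1.2 = n%:R * mean F.
Proof.
have [d count_d] := lc_regV L.
have -> : n%:R = #|'I_(lcV L)|%:R * d%:R :> R by rewrite card_ord -natrM -(size_by_vertex count_d).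
rewrite mulrAC mulr_mean mulr_suml.
rewrite sum_by_lcV; apply: eq_bigr => v _; rewrite (eq_bigr (fun=> F v)) => [|e /eqP -> //].
by rewrite big_const_seq iter_addr_0 count_d mulr_natr.
Qed.

(* The expectation over a uniform edge and a uniform edge with the same endpoint in U. *)
Definition pair_mean (F : edge -> edge -> R) : R :=
  (\sum_(e <- E) \sum_(e' <- E | e'.1.1 == e.1.1) F e e') / (n%:R * degU%:R).

Lemma pairs_gt0 : 0 < n%:R * degU%:R :> R.
Proof. by rewrite mulr_gt0 ?size_lcE_gt0 ?degU_gt0. Qed.

Lemma mulr_pair_mean F : n%:R * degU%:R * pair_mean F
  = \sum_(e <- E) \sum_(e' <- E | e'.1.1 == e.1.1) F e e'.
Proof. by rewrite /pair_mean mulrC divfK // lt0r_neq0 // pairs_gt0. Qed.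

Lemma pair_mean_const c : pair_mean (fun _ _ => c) = c.
Proof.
rewrite /pair_mean; under eq_bigr do rewrite big_const_seq iter_addr_0 count_degU.
rewrite big_const_seq iter_addr_0 count_predT -mulrnA -[_ *+ _]mulr_natr natrM.
by rewrite [_ * n%:R]mulrC mulfK // lt0r_neq0 // pairs_gt0.
Qed.

Lemma eq_pair_mean F G :
  {in E &, forall e e', e'.1.1 = e.1.1 -> F e e' = G e e'} -> pair_mean F = pair_mean G.
Proof.
move=> FG; congr (_ / _); rewrite [LHS]big_seq [RHS]big_seq; apply: eq_bigr => e eE.
rewrite [LHS]big_seq_cond [RHS]big_seq_cond; apply: eq_bigr => e' /andP [e'E /eqP eu].
exact: FG.
Qed.

Lemma ler_pair_mean F G : (forall e e', F e e' <= G e e') -> pair_mean F <= pair_mean G.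
Proof.
move=> FG; rewrite ler_wpM2r ?invr_ge0 ?(ltW pairs_gt0) //.
by do 2! (apply: ler_sum => ? _); exact: FG.
Qed.

Lemma pair_meanZ c F : pair_mean (fun e e' => c * F e e') = c * pair_mean F.
Proof.
rewrite /pair_mean mulrA; congr (_ / _); rewrite mulr_sumr.
by apply: eq_bigr => e _; rewrite mulr_sumr.
Qed.

Lemma pair_meanD F G :
  pair_mean (fun e e' => F e e' + G e e') = pair_mean F + pair_mean G.
Proof.
rewrite /pair_mean -mulrDl -big_split; congr (_ / _).
by apply: eq_bigr => e _; rewrite -big_split.
Qed.

Lemma pair_decoding (p : 'I_(lcV L) -> 'I_k -> R) :
  (forall v i, 0 <= p v i) -> (forall v, \sum_i p v i <= 1) ->
  pair_mean (fun e e' => \sum_i \sum_i' p e.1.2 i * p e'.1.2 i' * (e.2 i == e'.2 i')%:R)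
  <= Val R L.
Proof.
move=> p_ge0 p_le1; have d0 := degU_gt0.
pose r u j : R := degU%:R^-1
  * \sum_(e' <- E | e'.1.1 == u) \sum_i' p e'.1.2 i' * (j == e'.2 i')%:R.
have r_ge0 u j : 0 <= r u j.
  by rewrite mulr_ge0 ?invr_ge0 ?ler0n //; do 2! (apply: sumr_ge0 => ? _); rewrite mulr_ge0.
have r_le1 u : \sum_j r u j <= 1.
  rewrite -mulr_sumr exchange_big mulrC ler_pdivrMr // mul1r.
  rewrite -(count_degU u) -sum1_count natr_sum; apply: ler_sum => e _.
  apply: le_trans (p_le1 e.1.2); rewrite exchange_big; apply: ler_sum => i _ /=.
  rewrite (bigD1 (e.2 i)) //= eqxx mulr1 big1 ?addr0 // => j /negbTE ->.
  by rewrite mulr0.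
rewrite ler_pdivrMr ?pairs_gt0 // mulrA -ler_pdivrMr //.
apply: le_trans (fractional_labeling p_ge0 p_le1 r_ge0 r_le1).
rewrite le_eqVlt mulr_suml; apply/predU1P; left; apply: eq_bigr => e _.
rewrite exchange_big /= mulr_suml; apply: eq_bigr => i _.
rewrite /r mulrCA [RHS]mulrC; congr (_ / _); rewrite mulr_sumr; apply: eq_bigr => e' _.
by rewrite mulr_sumr; apply: eq_bigr => i' _; rewrite mulrA.
Qed.

Lemma pair_mean_sqr_ge (a : 'I_(lcV L) -> R) :
  mean a ^+ 4 <= pair_mean (fun e e' => a e.1.2 ^+ 2 * a e'.1.2 ^+ 2).
Proof.
pose Q u := \sum_(e <- E | e.1.1 == u) a e.1.2 ^+ 2.
rewrite ler_pdivlMr ?pairs_gt0 //.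
have -> : \sum_(e <- E) \sum_(e' <- E | e'.1.1 == e.1.1) a e.1.2 ^+ 2 * a e'.1.2 ^+ 2
    = \sum_u Q u ^+ 2.
  rewrite sum_by_lcU; apply: eq_bigr => u _; rewrite expr2 mulr_suml.
  by apply: eq_bigr => e /eqP ->; rewrite mulr_sumr.
have le_edges : n%:R * mean a ^+ 2 <= \sum_u Q u.
  have := sqr_sum_le E xpredT (fun e : edge => a e.1.2).
  rewrite sum_lcV -sum_by_lcU big_const_seq iter_addr_0 count_predT.
  by rewrite exprMn expr2 -mulrA ler_pM2l ?size_lcE_gt0.
have le_vertices := sqr_sum_le (index_enum _) xpredT Q.
have lcU0 : 0 < (lcU L)%:R :> R by rewrite ltr0n lcU_gt0.
rewrite -(ler_pM2l lcU0); apply: le_trans (le_trans _ le_vertices) _; last first.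
  by rewrite sumr_const card_ord.
have -> : (lcU L)%:R * (mean a ^+ 4 * (n%:R * degU%:R)) = (n%:R * mean a ^+ 2) ^+ 2.
  by rewrite size_degU natrM; ring.
have Q_ge0 : 0 <= \sum_u Q u by do 2! (apply: sumr_ge0 => ? _); exact: sqr_ge0.
by rewrite ler_sqr ?nnegrE // mulr_ge0 // sqr_ge0.
Qed.

End LabelCover.

(** * Completeness and soundness *)

Section Assignments.

Variables (R : realFieldType) (N : nat) (sigma : 'I_N -> 'F_2) (S : {set 'I_N}).

Definition indicator (i : 'I_N) : R := (i \in S)%:R.
Definition signed_indicator (i : 'I_N) : R := (i \in S)%:R * (-1) ^+ (sigma i != 0).

Lemma indicator_norm_le1 i : `|indicator i| <= 1.
Proof. by rewrite /indicator; case: (i \in S); rewrite ?normr1 ?normr0. Qed.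

Lemma signed_indicator_norm_le1 i : `|signed_indicator i| <= 1.
Proof. by rewrite normrM normrX normrN1 expr1n mulr1 indicator_norm_le1. Qed.

Lemma F2_cases (x : 'F_2) : x = 0 \/ x = 1.
Proof. by case: x => [[|[|]]] // lt_x; [left | right]; apply: val_inj. Qed.

Lemma F2_neq0D (x y : 'F_2) : (x + y != 0) = (x != 0) (+) (y != 0).
Proof. by case: (F2_cases x) => ->; case: (F2_cases y) => ->. Qed.

Lemma F2_eqE (x y : 'F_2) : (x == y) = ~~ ((y != 0) (+) (x != 0)).
Proof. by case: (F2_cases x) => ->; case: (F2_cases y) => ->. Qed.

Lemma prod_indicator (t : seq 'I_N) :
  \prod_(i <- t) indicator i = (all (fun i => i \in S) t)%:R.
Proof.
elim: t => [|i t IHt]; first by rewrite big_nil.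
by rewrite big_cons IHt /indicator /=; case: (i \in S); rewrite ?mul1r ?mul0r.
Qed.

Lemma prod_signed_indicator (t : seq 'I_N) :
  \prod_(i <- t) signed_indicator i
  = (all (fun i => i \in S) t)%:R * (-1) ^+ (\sum_(i <- t) sigma i != 0).
Proof.
rewrite big_split /= -prod_indicator; congr (_ * _).
elim: t => [|i t IHt]; first by rewrite !big_nil eqxx.
by rewrite !big_cons IHt F2_neq0D signr_addb.
Qed.

Variables (l : seq (lin_eqn N)) (uniq_l : all (fun t : lin_eqn N => uniq t.1) l).
Let H := Lin4 uniq_l.

Lemma size_lin_induced :
  (size (lin_induced (H := H) S))%:R = \sum_(t <- l) \prod_(i <- t.1) indicator i.
Proof.
rewrite size_filter -sum1_count natr_sum big_mkcond.
by apply: eq_bigr => t _; rewrite prod_indicator; case: (all _ _).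
Qed.

Lemma count_lin_induced :
  2 * (count (lin_sat (H := H) sigma) (lin_induced (H := H) S))%:R
    - (size (lin_induced (H := H) S))%:R
  = \sum_(t <- l) (-1) ^+ (t.2 != 0) * \prod_(i <- t.1) signed_indicator i.
Proof.
rewrite size_lin_induced count_filter -sum1_count natr_sum big_mkcond mulr_sumr -sumrB.
apply: eq_bigr => t _; rewrite prod_indicator prod_signed_indicator /lin_sat /= [_ == t.2]F2_eqE.
by case: (t.2 != 0); case: (_ != 0); case: (all _ _); rewrite /= ?expr0 ?expr1; ring.
Qed.

End Assignments.

Lemma ffact4_ge n : (n ^ 4 <= n ^_ 4 + 6 * n ^ 3)%N.
Proof.
case: n => [|[|[|[|n]]]] //.
by rewrite !ffactnS ffactn0 !expnS expn0 /=; nia.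
Qed.

Section TestMean.

Variables (R : realType) (q k s : nat) (L : label_cover k s).
Hypothesis q_gt1 : (1 < q)%N.

Local Notation nvar := (2 ^ k * s * lcV L)%N.
Local Notation copies := {ffun 'I_4 -> 'I_s}.
Local Notation distinct := (fun c : copies => (injectiveb c)%:R : R).
Implicit Types (h : 'I_nvar -> R) (eps : bool).

Definition test_mean (wt : copies -> R) eps h : R :=
  pair_mean (fun e e' => \mean_(r : coins k s q) \mean_(c : copies)
    (wt c * ((-1) ^+ (eps && test_sign r) * \prod_(i <- (test_eqn e e' r c).1) h i))).

Definition number_of_tests : R :=
  (size (lcE L))%:R * (degU L)%:R * #|{: coins k s q * copies}|%:R.

Lemma number_of_tests_gt0 : 0 < number_of_tests.
Proof.
rewrite mulr_gt0 ?pairs_gt0 // ltr0n card_prod muln_gt0 card_coins_gt0 ?(ltnW q_gt1) //.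
by rewrite card_ffun !card_ord expn_gt0 (lc_labelsU L).
Qed.

Lemma sum_test_eqns eps h :
  \sum_(t <- test_eqns q L) (-1) ^+ (eps && (t.2 != 0)) * \prod_(i <- t.1) h i
  = number_of_tests * test_mean distinct eps h.
Proof.
rewrite /number_of_tests mulrAC mulr_pair_mean big_bigcat mulr_suml; apply: eq_bigr => e _.
rewrite big_bigcat mulr_suml; apply: eq_bigr => e' _.
rewrite -(mean_pair (fun t : coins k s q * copies => distinct t.2 * ((-1) ^+ (eps && test_sign t.1)
  * \prod_(i <- (test_eqn e e' t.1 t.2).1) h i))) mulrC mulr_mean big_image big_mkcond.
apply: eq_bigr => -[r c] _; rewrite inE /=; case: (injectiveb c); last by rewrite mul0r.
by rewrite mul1r; case: (test_sign r).
Qed.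

Definition copy_mean h v x : R := \mean_(c : 'I_s) h (var v x c).

Lemma big_test_eqn (e e' : lc_edge (lcU L) (lcV L) k s) (r : coins k s q) c (f : 'I_nvar -> R) :
  \prod_(i <- (test_eqn e e' r c).1) f i
  = \prod_j f (var (tnth (test_points e.1.2 e'.1.2 e.2 e'.2 r) j).1
                   (tnth (test_points e.1.2 e'.1.2 e.2 e'.2 r) j).2 (c j)).
Proof. by rewrite big_map big_enum. Qed.

Lemma test_mean_local eps h :
  test_mean (fun=> 1) eps h
  = pair_mean (fun e e' => local_test q e.2 e'.2 eps (copy_mean h e.1.2) (copy_mean h e'.1.2)).
Proof.
apply: eq_pair_mean => e e' _ _ _; apply: eq_mean => r.
under eq_mean => c do rewrite mul1r big_test_eqn.
rewrite meanZ; congr (_ * _).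
set P := test_points _ _ _ _ r.
rewrite (mean_prod_ffun (fun j c => h (var (tnth P j).1 (tnth P j).2 c))).
rewrite -(big_tuple _ _ P xpredT (fun x => copy_mean h x.1 x.2)) /P.
by case: r {P} => -[[[[b z] w] w'] x] y; rewrite !big_cons !big_nil.
Qed.

Lemma copy_mean_norm_le1 h v x : (forall i, `|h i| <= 1) -> `|copy_mean h v x| <= 1.
Proof. by move=> h_le1; apply: mean_norm_le1. Qed.

Lemma mean_collisions : \mean_(c : copies) (~~ injectiveb c)%:R <= 6 / s%:R :> R.
Proof.
have s0 : 0 < s%:R :> R by rewrite ltr0n (lc_labelsU L).
rewrite /mean -natr_sum card_ffun !card_ord ler_pdivrMr ?ltr0n ?expn_gt0 ?(lc_labelsU L) //.
rewrite mulrAC ler_pdivlMr // -!natrM ler_nat.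
have -> : (\sum_(c : copies) ~~ injectiveb c = #|~: [set c : copies | injectiveb c]|)%N.
  rewrite -sum1_card [RHS]big_mkcond; apply: eq_bigr => c _.
  by rewrite !inE; case: (injectiveb c).
have := cardsC [set c : copies | injectiveb c]; rewrite card_inj_ffuns card_ffun !card_ord.
by have := ffact4_ge s; rewrite !expnS expn0; nia.
Qed.

Lemma prod_norm_le1 (I : Type) (r : seq I) (F : I -> R) :
  (forall i, `|F i| <= 1) -> `|\prod_(i <- r) F i| <= 1.
Proof.
move=> F_le1; elim/big_ind: _ => [|x y x1 y1|i _]; rewrite ?normr1 // normrM.
by rewrite mulr_ile1.
Qed.

Lemma test_mean_collisions (wt wt' : copies -> R) eps h :
  (forall i, `|h i| <= 1) -> (forall c : copies, `|wt c - wt' c| <= (~~ injectiveb c)%:R) ->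
  test_mean wt eps h <= test_mean wt' eps h + 6 / s%:R.
Proof.
move=> h_le1 close; rewrite -[6 / _](pair_mean_const L) -pair_meanD.
apply: ler_pair_mean => e e'; apply: (@le_trans _ _ (\mean_(r : coins k s q)
    (\mean_c (wt' c * ((-1) ^+ (eps && test_sign r) * \prod_(i <- (test_eqn e e' r c).1) h i))
     + \mean_(c : copies) (~~ injectiveb c)%:R))); last first.
  by rewrite meanD mean_const ?lerD2l ?mean_collisions // card_coins_gt0 // ltnW.
apply: ler_mean => r; rewrite -meanD; apply: ler_mean => c.
set T := (-1) ^+ _ * _.
have T_le1 : `|T| <= 1 by rewrite normrM normrX normrN1 expr1n mul1r prod_norm_le1.
rewrite -lerBlDl -mulrBl; apply: le_trans (ler_norm _) _; rewrite normrM.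
by apply: le_trans (close c); rewrite ler_piMr.
Qed.

Lemma mean_copy_mean h : \mean_v \mean_x copy_mean h v x = mean h.
Proof.
pose T : finType := ('I_(lcV L) * cube k * 'I_s)%type.
rewrite -(mean_pair (fun t : 'I_(lcV L) * cube k => copy_mean h t.1 t.2)).
rewrite -(mean_pair (fun t : T => h (var t.1.1 t.1.2 t.2))).
have inj : injective (fun t : T => var t.1.1 t.1.2 t.2).
  by move=> [[v x] c] [[v' x'] c'] /var_inj [/= -> -> ->].
have cardT : #|{: T}| = #|'I_nvar|.
  by rewrite !card_prod !card_ord card_ffun card_bool card_ord; lia.
rewrite /mean cardT; congr (_ / _).
by rewrite [RHS](reindex _ (onW_bij _ (inj_card_bij inj (eq_leq (esym cardT))))).
Qed.

Lemma mean_indicator (S : {set 'I_nvar}) : mean (indicator R S) = #|S|%:R / nvar%:R.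
Proof.
rewrite /mean card_ord; congr (_ / _); rewrite -sum1_card natr_sum [RHS]big_mkcond.
by apply: eq_bigr => i _; rewrite /indicator; case: (i \in S).
Qed.

Lemma test_mean_true_le h : (forall i, `|h i| <= 1) ->
  test_mean (fun=> 1) true h <= (q%:R / 2) ^+ 2 * Val R L.
Proof.
move=> h_le1; rewrite test_mean_local.
pose p v i := decode (copy_mean h v) i.
have p_le1 v : \sum_i p v i <= 1.
  apply: le_trans (sum_decode_le _) _.
  rewrite -[leRHS](mean_const 1 (card_cube_gt0 k)); apply: ler_mean => x.
  by rewrite -real_normK ?num_real // exprn_ile1 // copy_mean_norm_le1.
apply: (@le_trans _ _ ((q%:R / 2) ^+ 2 * pair_mean (fun e e' : lc_edge (lcU L) (lcV L) k s =>
    \sum_i \sum_i' p e.1.2 i * p e'.1.2 i' * (e.2 i == e'.2 i')%:R))); last first.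
  by rewrite ler_wpM2l ?sqr_ge0 // pair_decoding // => v i; exact: decode_ge0.
by rewrite -pair_meanZ; apply: ler_pair_mean => e e'; exact: local_test_true_le.
Qed.

Lemma test_mean_false_ge h : mean h ^+ 4 <= test_mean (fun=> 1) false h.
Proof.
rewrite test_mean_local -mean_copy_mean.
apply: le_trans (pair_mean_sqr_ge (fun v => mean (copy_mean h v))) _.
by apply: ler_pair_mean => e e'; exact: local_test_false_ge.
Qed.

Lemma mean_flip (i : 'I_k) :
  \mean_(w : {ffun 'I_k -> 'I_q}) (-1) ^+ noise w i = 1 - 2 / q%:R :> R.
Proof.
pose d : cube k := [ffun j => j == i].
have chi_d x : chi R d x = (-1) ^+ x i.
  rewrite /chi (bigD1 i) //= ffunE eqxx big1 ?mulr1 // => j /negbTE ji.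
  by rewrite ffunE ji.
have weight_d : weight d = 1%N.
  by rewrite /weight (bigD1 i) //= ffunE eqxx big1 ?addn0 // => j /negbTE ji; rewrite ffunE ji.
transitivity (noise_mean R q d); first by apply: eq_mean => w; rewrite chi_d.
by rewrite noise_meanE ?(ltnW q_gt1) // weight_d.
Qed.

Lemma mean_noise (f g : {ffun 'I_k -> 'I_q} -> R) :
  \mean_(r : coins k s q) (let: (b, z, w, w', x, y) := r in f w * g w') = mean f * mean g.
Proof.
have q_gt0 := ltnW q_gt1.
have noise_gt0 : (0 < #|{: {ffun 'I_k -> 'I_q}}|)%N by rewrite card_ffun !card_ord expn_gt0 q_gt0.
rewrite mean_coins; under eq_mean => b do under eq_mean => z do under eq_mean => w do
  under eq_mean => w' do rewrite !mean_const ?card_cube_gt0 //.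
by rewrite [RHS]mean_mul mean_const ?card_bool // mean_const ?card_cube_gt0.
Qed.

Lemma dictator_test (labU : 'I_(lcU L) -> 'I_s) (labV : 'I_(lcV L) -> 'I_k) h
    (e e' : lc_edge (lcU L) (lcV L) k s) b z (w w' : {ffun 'I_k -> 'I_q}) x y c :
  (forall v x c, h (var v x c) = (-1) ^+ (x (labV v) : bool)) ->
  e'.1.1 = e.1.1 -> e.2 (labV e.1.2) = labU e.1.1 -> e'.2 (labV e'.1.2) = labU e'.1.1 ->
  (-1) ^+ (b : bool) * \prod_(i <- (test_eqn e e' (b, z, w, w', x, y) c).1) h i
  = (-1) ^+ noise w (labV e.1.2) * (-1) ^+ noise w' (labV e'.1.2).
Proof.
move=> h_dict same_u sat sat'; rewrite big_test_eqn !big_ord_recl big_ord0.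
rewrite !(tnth_nth (e.1.2, x)) /= !h_dict !ffunE sat sat' same_u mulr1 -!signr_addb.
congr (_ ^+ nat_of_bool _); move: (z _) (x _) (y _) (_ == _) (_ == _).
by case: b => [] [] [] [] [] [].
Qed.

Lemma assignment_exists (f : 'I_(lcV L) -> cube k -> bool) :
  exists sigma : 'I_nvar -> 'F_2, forall v x c, (sigma (var v x c) != 0) = f v x.
Proof.
pose onto j (t : 'I_(lcV L) * cube k * 'I_s) := var t.1.1 t.1.2 t.2 == j.
exists (fun j => [exists t, onto j t && f t.1.1 t.1.2]%:R) => v x c.
have -> : [exists t, onto (var v x c) t && f t.1.1 t.1.2] = f v x.
  apply/existsP/idP => [[[[v' x'] c'] /andP [/eqP /var_inj [/= -> -> _]]] // | fvx].
  by exists (v, x, c); rewrite /onto eqxx.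
by case: (f v x).
Qed.

Lemma dictator_test_mean (lab : labeling L) h :
  {in lcE L, forall e, lc_sat lab e} ->
  (forall v x c, h (var v x c) = (-1) ^+ (x (lab.2 v) : bool)) ->
  test_mean distinct true h
  = (1 - 2 / q%:R) ^+ 2 * test_mean distinct false (indicator R setT).
Proof.
move=> sat_lab h_dict; rewrite -pair_meanZ; apply: eq_pair_mean => e e' eE e'E same_u.
have coins_gt0 := card_coins_gt0 k s (ltnW q_gt1).
have -> : \mean_(r : coins k s q) \mean_c (distinct c * ((-1) ^+ (false && test_sign r)
    * \prod_(i <- (test_eqn e e' r c).1) indicator R setT i)) = mean distinct.
  rewrite -[RHS](mean_const _ coins_gt0); apply: eq_mean => r; apply: eq_mean => c.
  by rewrite big1 ?mulr1 // => i _; rewrite /indicator inE.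
rewrite expr2 -{1}(mean_flip (lab.2 e.1.2)) -(mean_flip (lab.2 e'.1.2)).
rewrite -mean_noise -meanZr; apply: eq_mean => -[[[[[b z] w] w'] x] y].
rewrite -meanZ; apply: eq_mean => c /=; rewrite mulrC.
by rewrite (dictator_test (labU := lab.1) (labV := lab.2)) //; exact/eqP/sat_lab.
Qed.

Section Instance.

Variables (l : seq (lin_eqn nvar)) (uniq_l : all (fun t : lin_eqn nvar => uniq t.1) l).
Hypothesis perm_l : perm_eq l (test_eqns q L).
Let H := Lin4 uniq_l.

Lemma size_lin_induced_test S :
  (size (lin_induced (H := H) S))%:R
  = number_of_tests * test_mean distinct false (indicator R S).
Proof.
rewrite size_lin_induced (perm_big _ perm_l) -sum_test_eqns.
by apply: eq_bigr => t _; rewrite expr0 mul1r.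
Qed.

Lemma count_lin_induced_test S sigma :
  2 * (count (lin_sat (H := H) sigma) (lin_induced (H := H) S))%:R
    - (size (lin_induced (H := H) S))%:R
  = number_of_tests * test_mean distinct true (signed_indicator R sigma S).
Proof. by rewrite count_lin_induced (perm_big _ perm_l) -sum_test_eqns. Qed.

Lemma soundness (alpha nu : R) (S : {set 'I_nvar}) (sigma : 'I_nvar -> 'F_2) :
  0 <= alpha -> 0 <= nu <= 1 -> alpha * nvar%:R <= #|S|%:R ->
  (1 / 2 + nu) * (size (lin_induced (H := H) S))%:R
    <= (count (lin_sat (H := H) sigma) (lin_induced (H := H) S))%:R ->
  2 * nu * alpha ^+ 4 <= Val R L * (q%:R ^+ 2 / 4 + 18).
Proof.
move=> alpha0 /andP [nu0 nu1] large_S advantage.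
have s0 := lc_labelsU L.
have nvar0 : 0 < nvar%:R :> R by rewrite ltr0n !muln_gt0 expn_gt0 s0 lcV_gt0.
have density : alpha <= mean (indicator R S) by rewrite mean_indicator ler_pdivlMr.
have bias : 2 * nu * test_mean distinct false (indicator R S)
    <= test_mean distinct true (signed_indicator R sigma S).
  rewrite -(ler_pM2l number_of_tests_gt0) -count_lin_induced_test mulrCA -size_lin_induced_test.
  by lra.
have close_distinct (c : copies) : `|distinct c - 1| <= (~~ injectiveb c)%:R.
  by case: (injectiveb c); rewrite ?subrr ?normr0 // sub0r normrN1.
have close_all (c : copies) : `|1 - distinct c| <= (~~ injectiveb c)%:R.
  by rewrite distrC close_distinct.
have bias_le := test_mean_collisions true (signed_indicator_norm_le1 R sigma S) close_distinct.
have density_le := test_mean_collisions false (indicator_norm_le1 R S) close_all.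
have upper := test_mean_true_le (signed_indicator_norm_le1 R sigma S).
have lower : alpha ^+ 4 <= test_mean (fun=> 1) false (indicator R S).
  by apply: le_trans (test_mean_false_ge _); rewrite lerXn2r ?nnegrE // (le_trans alpha0).
have inv_s := Val_ge_invs R L.
have : 2 * nu * alpha ^+ 4 <= 2 * nu * (test_mean distinct false (indicator R S) + 6 / s%:R).
  by rewrite ler_wpM2l ?mulr_ge0 // (le_trans lower).
have : nu * (6 / s%:R) <= 1 * (6 / s%:R) by rewrite ler_wpM2r // divr_ge0.
have : (q%:R / 2) ^+ 2 * Val R L = Val R L * (q%:R ^+ 2 / 4) by field.
lra.
Qed.

Lemma completeness : Val R L = 1 ->
  exists sigma, (1 - 2 / q%:R) * (size l)%:R <= (count (lin_sat (H := H) sigma) l)%:R :> R.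
Proof.
case/Val1_labeling=> -[labU labV] /allP sat_lab.
have [sigma sigmaE] := assignment_exists (fun v x => x (labV v)); exists sigma.
have inducedT : lin_induced (H := H) setT = l.
  by apply/all_filterP/allP => t _; apply/allP => i _; rewrite inE.
have := count_lin_induced_test setT sigma; rewrite inducedT.
pose rho : R := 1 - 2 / q%:R; rewrite -/rho.
have -> : test_mean distinct true (signed_indicator R sigma setT)
    = rho ^+ 2 * test_mean distinct false (indicator R setT).
  apply: dictator_test_mean sat_lab _ => v x c.
  by rewrite /signed_indicator inE mul1r sigmaE.
rewrite mulrCA -size_lin_induced_test inducedT => count_l.
have := sqr_ge0 (1 - rho); have : 0 <= (size l)%:R :> R by [].
by move=> size_ge0 /(mulr_ge0 size_ge0); lra.
Qed.

End Instance.

End TestMean.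

Lemma exists_noise_alphabet (R : realType) (eta : R) : 0 < eta < 1 ->
  exists q : nat, [/\ (1 < q)%N, 1 <= eta * q%:R & eta * q%:R <= 2].
Proof.
case/andP=> eta0 eta1; have etaV0 : 0 < eta^-1 by rewrite invr_gt0.
have /andP [le_etaV lt_etaV] := Num.Theory.truncn_itv (ltW etaV0).
exists (Num.truncn eta^-1).+1; split.
- by rewrite -(ltr_nat R); apply: le_lt_trans lt_etaV; rewrite ltW // invf_gt1.
- by rewrite -ler_pdivrMl // mulr1 ltW.
rewrite -natr1 mulrDr mulr1 -[2]/(1 + 1) lerD //; last exact: ltW.
by rewrite -ler_pdivlMl // mulr1.
Qed.

Lemma soundness_scaled (R : realFieldType) (V eta alpha nu q : R) :
  0 <= V -> 0 < eta < 1 -> 0 <= q -> eta * q <= 2 -> 0 < alpha < 1 -> 0 < nu ->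
  2 * nu * alpha ^+ 4 <= V * (q ^+ 2 / 4 + 18) ->
  2 / 19 * (nu * alpha ^+ 16 * eta ^+ 2) <= V.
Proof.
move=> V0 /andP [eta0 eta1] q0 eta_q /andP [alpha0 alpha1] nu0 sound.
have eta2_le1 : eta ^+ 2 <= 1 by rewrite exprn_ile1 // ltW.
have eta_q_ge0 : 0 <= eta * q by rewrite mulr_ge0 // ltW.
have eta_q2_le : (eta * q) ^+ 2 <= 4 by nra.
have alpha_le : nu * alpha ^+ 16 <= nu * alpha ^+ 4.
  by rewrite ler_wpM2l ?(ltW nu0) // ler_wiXn2l // ltW.
have {}alpha_le := ler_wpM2r (sqr_ge0 eta) alpha_le.
have {}sound := ler_wpM2r (sqr_ge0 eta) sound.
have : V * ((eta * q) ^+ 2 / 4 + 18 * eta ^+ 2) <= V * 19 by rewrite ler_wpM2l //; lra.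
have -> : V * ((eta * q) ^+ 2 / 4 + 18 * eta ^+ 2) = V * (q ^+ 2 / 4 + 18) * eta ^+ 2 by field.
lra.
Qed.

Theorem theorem7p3 (R : realType) :
  exists2 c : R, 0 < c &
  forall eta : R, 0 < eta < 1 ->
  exists2 P : expr, efficient P &
  forall (k s : nat) (L : label_cover k s),
  exists2 H : lin4, outputs P L H &
    (Val R L = 1 ->
       exists sigma : 'I_(lin_nvar H) -> 'F_2,
         (1 - 2 * eta) * (size (lin_eqs H))%:R
           <= (count (lin_sat sigma) (lin_eqs H))%:R)
    /\
    (forall alpha nu : R, 0 < alpha < 1 -> 0 < nu < 1 ->
       (exists (S : {set 'I_(lin_nvar H)}) (sigma : 'I_(lin_nvar H) -> 'F_2),
          alpha * (lin_nvar H)%:R <= #|S|%:R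
          /\ (1 / 2 + nu) * (size (lin_induced S))%:R
               <= (count (lin_sat sigma) (lin_induced S))%:R) ->
       c * (nu * alpha ^+ 16 * eta ^+ 2) <= Val R L).
Proof.
exists (2 / 19) => [|eta eta01]; first by lra.
have [q [q_gt1 eta_q_ge1 eta_q_le2]] := exists_noise_alphabet eta01.
exists (reduction q); first exact: efficient_reduction.
move=> k s L; have [l [uniq_l [perm_l outputs_l]]] := outputs_reduction q L.
exists (Lin4 uniq_l) => //; split=> [Val1|alpha nu alpha01 /andP [nu0 nu1] [S [sigma [dense sat]]]].
  have [sigma sat] := completeness q_gt1 uniq_l perm_l Val1; exists sigma; apply: le_trans sat.
  rewrite ler_wpM2r // lerD2l lerN2 ler_pdivrMr ?ltr0n ?(ltnW q_gt1) // -mulrA.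
  by rewrite ler_peMr.
apply: (soundness_scaled (Val_ge0 R L) eta01 (ler0n _ q) eta_q_le2 alpha01 nu0).
by apply: (soundness q_gt1 perm_l _ _ dense sat); [case/andP: alpha01 => /ltW | rewrite !ltW].
Qed.
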